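(* Let $(\mathbf{X}, D, Y(0),Y(1),S(0),S(1))$ satisfy strong ignorability (that is, $(Y(1),Y(0),S(1),S(0))$ is independent of $D$ conditional on $\mathbf{X}$, and $\varepsilon<P(D=1\mid\mathbf{X})<1-\varepsilon$ for some $\varepsilon>0$) and monotonic selection ($S(1)\ge S(0)$). Let $\tau(1,1)=E[Y(1)-Y(0)\mid S(0)=S(1)=1]$ be the average treatment effect for always-responders, let $\tau^L_{TB}(1,1),\tau^U_{TB}(1,1)$ be the basic trimming bounds, and let $\tau^L_{CTB}(1,1),\tau^U_{CTB}(1,1)$ be the aggregated covariate-tightened trimming bounds, all as defined in the context. Then $$ \tau^L_{TB}(1, 1) \leq \tau^L_{CTB}(1, 1) \leq \tau(1, 1) \leq \tau^U_{CTB}(1, 1) \leq \tau^U_{TB}(1, 1). $$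
   Context: **Setup.** $\mathbf{X}\in\mathbb{R}^P$ are covariates with distribution $F$; $D\in\{0,1\}$ is a treatment; $(Y(0),Y(1))$ are real-valued integrable potential outcomes; $(S(0),S(1))\in\{0,1\}^2$ are potential response indicators. $Y=DY(1)+(1-D)Y(0)$ and $S=DS(1)+(1-D)S(0)$; $Y$ is observed only if $S=1$. The outcome is continuous: the conditional distribution of $Y$ given $D=1,S=1,\mathbf{X}=\mathbf{x}$ has a density. Assume $P(S(0)=S(1)=1)>0$. **Conditional quantities.** $q_d(\mathbf{x})=P(S=1\mid D=d,\mathbf{X}=\mathbf{x})$ for $d\in\{0,1\}$, and $q(\mathbf{x})=q_0(\mathbf{x})/q_1(\mathbf{x})$. Let $y_u(\mathbf{x})$ be the $u$-quantile of the distribution of $Y$ given $D=1,S=1,\mathbf{X}=\mathbf{x}$. Define $\theta_0(\mathbf{x})=E[Y\mid D=0,S=1,\mathbf{X}=\mathbf{x}]$, $\theta_1^L(\mathbf{x})=E[Y\mid D=1,S=1,\mathbf{X}=\mathbf{x},Y\le y_{q(\mathbf{x})}(\mathbf{x})]$, $\theta_1^U(\mathbf{x})=E[Y\mid D=1,S=1,\mathbf{X}=\mathbf{x},Y\ge y_{1-q(\mathbf{x})}(\mathbf{x})]$ (when $q(\mathbf{x})=1$ there is no trimming). **Covariate-tightened trimming bounds.** For $B\in\{L,U\}$, $$\tau^B_{CTB}(1,1)=\frac{\int(\theta_1^B(\mathbf{x})-\theta_0(\mathbf{x}))\,q_0(\mathbf{x})\,dF(\mathbf{x})}{\int q_0(\mathbf{x})\,dF(\mathbf{x})},$$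 where the integrand in the numerator is taken to be $0$ where $q_0(\mathbf{x})=0$. **Basic trimming bounds** (these do not condition the trimming on covariates; under conditional randomization, expectations are iterated expectations that condition on $\mathbf{X}$ and then marginalize over $\mathbf{X}$). Let $q=\int q_0\,dF\big/\int q_1\,dF$. Let $G$ be the distribution function $G(y)=\int P(Y\le y\mid D=1,S=1,\mathbf{X}=\mathbf{x})\,q_1(\mathbf{x})\,dF(\mathbf{x})\big/\int q_1\,dF$, and let $y_u$ be the $u$-quantile of $G$. Let $\mu_0=\int\theta_0(\mathbf{x})q_0(\mathbf{x})\,dF(\mathbf{x})\big/\int q_0\,dF$. Then $$\tau^L_{TB}(1,1)=\frac1q\int_{(-\infty,y_q]}y\,dG(y)-\mu_0,\qquad \tau^U_{TB}(1,1)=\frac1q\int_{[y_{1-q},\infty)}y\,dG(y)-\mu_0$$ (no trimming when $q=1$). When $D$ is unconditionally randomized (independent of $\mathbf{X}$ as well as of all potential variables), these reduce to $E[Y\mid D=1,S=1,Y\le y_q]-E[Y\mid D=0,S=1]$ and $E[Y\mid D=1,S=1,Y\ge y_{1-q}]-E[Y\mid D=0,S=1]$ with $q=P(S=1\mid D=0)/P(S=1\mid D=1)$. *)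

(* Defs.v *)
From HB Require Import structures.
From mathcomp Require Import all_boot all_order all_algebra.
From mathcomp Require Import all_classical all_reals all_analysis.
From mathcomp Require Import measurable_realfun.

Set Implicit Arguments.
Unset Strict Implicit.
Unset Printing Implicit Defensive.
Import Order.TTheory GRing.Theory Num.Theory.
Import numFieldNormedType.Exports.

Local Open Scope classical_set_scope.
Local Open Scope ring_scope.

(* Elementary conditioning on an event E; both quantities are 0 by convention
   (x / 0 = 0) when E is null. *)
Section elementary_conditioning.
Context d (T : measurableType d) (R : realType).
Variable mu : {measure set T -> \bar R}.

Definition cond_prob (A E : set T) : R := fine (mu (A `&` E)) / fine (mu E).

Definition cond_mean (f : T -> R) (E : set T) : R :=
  (\int[mu]_(w in E) f w) / fine (mu E).

End elementary_conditioning.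

(* The left u-quantile of the distribution with distribution function H;
   meaningful only for 0 < u < 1. *)
Definition quantile (R : realType) (H : R -> R) (u : R) : R :=
  inf [set y | u <= H y].

(* ((S(0), S(1)), (Y(0), Y(1))), and the same preceded by the treatment D. *)
Notation potential R := ((bool * bool) * (R * R))%type.
Notation unit_data R := (bool * potential R)%type.

Definition joint (T R : Type) (D S0 S1 : T -> bool) (Y0 Y1 : T -> R) (w : T) :
  unit_data R := (D w, ((S0 w, S1 w), (Y0 w, Y1 w))).

Section observables.
Context {R : realType}.
Implicit Types v : unit_data R.

Definition treat v : bool := v.1.
Definition resp v : bool := if treat v then v.2.1.2 else v.2.1.1.
Definition outcome v : R := if treat v then v.2.2.2 else v.2.2.1.

(* The cell D = a, S = 1. *)
Definition cell (a : bool) : set (unit_data R) :=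
  [set v | treat v = a /\ resp v = true].

Lemma measurable_treat : measurable_fun setT treat.
Proof. exact: measurable_fst. Qed.

Lemma measurable_resp : measurable_fun setT resp.
Proof.
by apply: measurable_fun_ifT; [exact: measurable_treat|..];
  do 2 apply: measurableT_comp => //; exact: measurable_snd.
Qed.

Lemma measurable_outcome : measurable_fun setT outcome.
Proof.
by apply: measurable_fun_ifT; [exact: measurable_treat|..];
  do 2 apply: measurableT_comp => //; exact: measurable_snd.
Qed.

Lemma measurable_treat_set a : measurable [set v | treat v = a].
Proof.
rewrite -[X in measurable X]setTI.
exact: (measurable_treat measurableT (Y := [set a])).
Qed.

Lemma measurable_resp_set : measurable [set v | resp v = true].
Proof.
rewrite -[X in measurable X]setTI.
exact: (measurable_resp measurableT (Y := [set true])).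
Qed.

Lemma measurable_cell a : measurable (cell a).
Proof.
apply: measurableI; first exact: measurable_treat_set.
exact: measurable_resp_set.
Qed.

End observables.

(* k is a regular conditional distribution of W given X under P. *)
Definition is_rcd (R : realType) d dX dW (T : measurableType d)
    (TX : measurableType dX) (TW : measurableType dW) (P : probability T R)
    (X : {RV P >-> TX}) (W : T -> TW) (k : R.-pker TX ~> TW) : Prop :=
  forall (B : set TX) (A : set TW), measurable B -> measurable A ->
    P (X @^-1` B `&` W @^-1` A) = (\int[distribution P X]_(x in B) k x A)%E.

(* F stands for the distribution of X and k for a regular conditional
   distribution of (D, S(0), S(1), Y(0), Y(1)) given X. Conditioning on X = x
   together with further events is elementary conditioning under k x. *)
Section bounds.
Context {R : realType} {p : nat}.
Variables (F : probability (p.-tuple R) R)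
          (k : R.-pker (p.-tuple R) ~> (unit_data R)).
Implicit Types (x : p.-tuple R) (y u : R) (a : bool).

Definition strong_ignorability : Prop :=
  (forall (a : bool) (A : set (potential R)), measurable A ->
     {ae F, forall x,
       k x [set v | treat v = a /\ A v.2] =
       (k x [set v | treat v = a] * k x [set v | A v.2])%E}) /\
  (exists2 e : R, 0 < e &
     {ae F, forall x,
       (e%:E < k x [set v | treat v = true] < (1 - e)%:E)%E}).

Definition continuous_outcome : Prop :=
  {ae F, forall x, (0 < k x (cell true))%E ->
    exists f : R -> R,
      [/\ measurable_fun setT f,
          forall y, 0 <= f y &
          forall A : set R, measurable A ->
            (cond_prob (k x) (outcome @^-1` A) (cell true))%:E =
            (\int[lebesgue_measure]_(y in A) (f y)%:E)%E]}.

Definition resp_rate a x : R :=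
  cond_prob (k x) [set v | resp v = true] [set v | treat v = a].

Definition resp_ratio x : R := resp_rate false x / resp_rate true x.

Definition treated_cdf x y : R :=
  cond_prob (k x) [set v | outcome v <= y] (cell true).

Definition theta0 x : R := cond_mean (k x) outcome (cell false).

(* When the ratio is 1 the quantile of order 1 may be infinite (inf set0 = 0 and
   not +oo), hence the explicit untrimmed branch here and in tau_TB_L, tau_TB_U. *)
Definition theta1L x : R :=
  cond_mean (k x) outcome
    (if resp_ratio x == 1 then cell true else
     cell true `&`
       [set v | outcome v <= quantile (treated_cdf x) (resp_ratio x)]).

Definition theta1U x : R :=
  cond_mean (k x) outcome
    (if resp_ratio x == 1 then cell true else
     cell true `&`
       [set v | quantile (treated_cdf x) (1 - resp_ratio x) <= outcome v]).

(* The integrand vanishes where resp_rate false x = 0: theta1 x and theta0 x are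
   total, with junk values there. *)
Definition ctb_bound (theta1 : p.-tuple R -> R) : R :=
  (\int[F]_x ((theta1 x - theta0 x) * resp_rate false x)) /
  (\int[F]_x resp_rate false x).

Definition tau_CTB_L : R := ctb_bound theta1L.
Definition tau_CTB_U : R := ctb_bound theta1U.

Definition tb_ratio : R :=
  (\int[F]_x resp_rate false x) / (\int[F]_x resp_rate true x).

Definition tb_cdf y : R :=
  (\int[F]_x (treated_cdf x y * resp_rate true x)) /
  (\int[F]_x resp_rate true x).

(* The measure dG of the distribution function G = tb_cdf; see tb_law_cdf. *)
Definition tb_law (A : set R) : \bar R :=
  ((\int[F]_x (cond_prob (k x) (outcome @^-1` A) (cell true)
              * resp_rate true x)%:E) *
   ((\int[F]_x resp_rate true x)^-1)%:E)%E.

Lemma cond_prob_ge0 d (T : measurableType d) (mu : {measure set T -> \bar R})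
  (A E : set T) : 0 <= cond_prob mu A E.
Proof. by rewrite divr_ge0 ?fine_ge0. Qed.

Lemma kernel_fin_num x (A : set (unit_data R)) :
  measurable A -> k x A \is a fin_num.
Proof.
move=> mA; rewrite ge0_fin_numE//.
by rewrite (@le_lt_trans _ _ (k x setT)) ?le_measure ?inE// prob_kernel ltry.
Qed.

Lemma cond_prob_le1 x (A E : set (unit_data R)) :
  measurable A -> measurable E -> cond_prob (k x) A E <= 1.
Proof.
move=> mA mE; have mAE := measurableI _ _ mA mE.
have le : fine (k x (A `&` E)) <= fine (k x E).
  by rewrite fine_le ?kernel_fin_num// le_measure ?inE.
rewrite /cond_prob; have [->|E0] := eqVneq (fine (k x E)) 0.
  by rewrite invr0 mulr0.
by rewrite ler_pdivrMr ?mul1r// lt_neqAle eq_sym E0 fine_ge0.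
Qed.

Lemma measurable_invr : measurable_fun setT (@GRing.inv R).
Proof.
rewrite (_ : @GRing.inv R = fun r => if r == 0 then 0 else r^-1); last first.
  by apply/funext => r; case: eqP => // ->; rewrite invr0.
have m0 : measurable_fun setT (fun r : R => r == 0).
  exact: measurable_fun_eqr.
apply: measurable_fun_if => //.
rewrite setTI; apply: (@measurable_funS _ _ _ _ [set r : R | r != 0]).
- exact: open_measurable.
- by move=> r /= /negbT.
- apply: open_continuous_measurable_fun => //; apply/in_setP => x /= x0.
  exact: inv_continuous.
Qed.

Lemma measurable_cond_prob (A E : set (unit_data R)) :
  measurable A -> measurable E ->
  measurable_fun setT (fun x => cond_prob (k x) A E).
Proof.
move=> mA mE; apply: measurable_funM.
  apply: measurableT_comp => //.
  by apply: measurable_kernel; exact: measurableI.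
apply: (measurableT_comp measurable_invr).
by apply: measurableT_comp => //; exact: measurable_kernel.
Qed.

Lemma measurable_resp_rate a : measurable_fun setT (resp_rate a).
Proof.
apply: measurable_cond_prob; last exact: measurable_treat_set.
exact: measurable_resp_set.
Qed.

Let tb_law0 : tb_law set0 = 0%E.
Proof.
rewrite /tb_law (eq_integral (cst 0%E)) ?integral0 ?mul0e// => x _.
by rewrite preimage_set0 /cond_prob set0I measure0 !mul0r.
Qed.

Let tb_law_ge0 A : (0 <= tb_law A)%E.
Proof.
apply: mule_ge0.
  by apply: integral_ge0 => x _; rewrite lee_fin mulr_ge0// cond_prob_ge0.
rewrite lee_fin invr_ge0; apply: Rintegral_ge0 => x _; exact: cond_prob_ge0.
Qed.

Let tb_law_sigma_additive : semi_sigma_additive tb_law.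
Proof.
move=> A mA tA mUA.
pose c x := (fine (k x (cell true)))^-1 * resp_rate true x.
have c0 x : 0 <= c x.
  by rewrite mulr_ge0 ?invr_ge0 ?fine_ge0// cond_prob_ge0.
pose h n x := (cond_prob (k x) (outcome @^-1` A n) (cell true)
              * resp_rate true x)%:E.
have mouts B : measurable B -> measurable (outcome @^-1` B : set (unit_data R)).
  by move=> mB; rewrite -[X in measurable X]setTI; exact: measurable_outcome.
have hE B x : measurable B ->
    (cond_prob (k x) (outcome @^-1` B) (cell true) * resp_rate true x)%:E =
    ((c x)%:E * k x (outcome @^-1` B `&` cell true))%E.
  move=> mB; rewrite /cond_prob -mulrA EFinM -/(c x) muleC fineK//.
  by apply: kernel_fin_num; apply: measurableI; [exact: mouts|exact: measurable_cell].
have mh n : measurable_fun setT (h n).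
  apply/measurable_EFinP; apply: measurable_funM.
    by apply: measurable_cond_prob; [exact: mouts|exact: measurable_cell].
  exact: measurable_resp_rate.
have h0 n x : setT x -> (0 <= h n x)%E.
  by move=> _; rewrite lee_fin mulr_ge0// cond_prob_ge0.
apply/cvg_closeP; split; first by apply: is_cvg_nneseries.
rewrite closeE//.
rewrite [RHS]/tb_law (_ : \int[F]_x _ = \sum_(0 <= n <oo) \int[F]_x h n x)%E.
  rewrite muleC -nneseriesZl; last by move=> n _; apply: integral_ge0 => x; exact: h0.
  by congr (limn _); apply/funext => n; apply: eq_bigr => i _; rewrite muleC.
rewrite -integral_nneseries//; apply: eq_integral => x _.
rewrite hE// preimage_bigcup setI_bigcupl measure_bigcup//.
- rewrite -nneseriesZl//.
  rewrite (@eq_eseriesl _ _ xpredT) => [|n]; last exact: in_setT.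
  by apply: eq_eseriesr => n _; rewrite /h hE.
- by move=> n _; apply: measurableI; [exact: mouts|exact: measurable_cell].
- apply/trivIsetP => i j _ _ ij; rewrite setIACA -preimage_setI.
  by move/trivIsetP : tA => /(_ _ _ _ _ ij) ->//; rewrite preimage_set0 set0I.
Qed.

HB.instance Definition _ :=
  isMeasure.Build _ _ _ tb_law tb_law0 tb_law_ge0 tb_law_sigma_additive.

End bounds.

Section basic_bounds.
Context {R : realType} {p : nat}.
Variables (F : probability (p.-tuple R) R)
          (k : R.-pker (p.-tuple R) ~> (unit_data R)).

Lemma tb_law_cdf y : tb_law F k `]-oo, y] = (tb_cdf F k y)%:E.
Proof.
rewrite /tb_law /tb_cdf EFinM; congr (_ * _)%E.
have -> : outcome @^-1` `]-oo, y] = [set v : unit_data R | outcome v <= y].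
  by apply/seteqP; split => v /=; rewrite in_itv.
rewrite /Rintegral fineK//; apply: integrable_fin_num => //.
have mE : measurable [set v : unit_data R | outcome v <= y].
  rewrite -[X in measurable X]setTI -preimage_itvNyc.
  exact: measurable_outcome.
apply: measurable_bounded_integrable => //.
- by rewrite (le_lt_trans (probability_le1 F measurableT))// ltry.
- apply: measurable_funM; last exact: measurable_resp_rate.
  by apply: measurable_cond_prob => //; exact: measurable_cell.
- exists 1; split => // M M1 x _ /=; apply: le_trans (ltW M1).
  rewrite ger0_norm ?mulr_ge0 ?cond_prob_ge0//.
  apply: mulr_ile1; rewrite ?cond_prob_ge0//; apply: cond_prob_le1 => //.
  + exact: measurable_cell.
  + exact: measurable_resp_set.
  + exact: measurable_treat_set.
Qed.

Definition mu0 : R :=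
  (\int[F]_x (theta0 k x * resp_rate k false x)) /
  (\int[F]_x resp_rate k false x).

Definition tau_TB_L : R :=
  (tb_ratio F k)^-1 *
    (\int[tb_law F k]_(y in (if tb_ratio F k == 1 then setT
                         else [set y | y <= quantile (tb_cdf F k) (tb_ratio F k)])) y)
  - mu0.

Definition tau_TB_U : R :=
  (tb_ratio F k)^-1 *
    (\int[tb_law F k]_(y in (if tb_ratio F k == 1 then setT
                         else [set y | quantile (tb_cdf F k) (1 - tb_ratio F k) <= y])) y)
  - mu0.

End basic_bounds.

Definition tau_11 (R : realType) d (T : measurableType d)
    (P : probability T R) (S0 S1 : T -> bool) (Y0 Y1 : T -> R) : R :=
  cond_mean P (fun w => Y1 w - Y0 w) [set w | S0 w = true /\ S1 w = true].

(* Main.v *)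
Require Import Defs.
From HB Require Import structures.
From mathcomp Require Import all_boot all_order all_algebra.
From mathcomp Require Import all_classical all_reals all_analysis.
From mathcomp Require Import measurable_realfun.
Set Implicit Arguments.
Unset Strict Implicit.
Unset Printing Implicit Defensive.
Import Order.TTheory GRing.Theory Num.Theory.
Import numFieldNormedType.Exports.
Local Open Scope classical_set_scope.
Local Open Scope ring_scope.

(* Under ignorability, k x (D = a, A) / k x (D = a) is the conditional
   probability of an event A on the potential variables given X = x.  Hence,
   writing mu_x for the sub-probability k x (D = 1, S = 1, .) / k x (D = 1), all
   the bounds become integrals over x of expressions in mu_x alone: q_1 x is the
   mass of mu_x, q_0 x is by monotonicity the mu_x-mass of the always-responders,
   and dG is the normalized mixture of the mu_x.  The covariate-tightened bound
   integrates Y over a tail of mu_x of mass q_0 x, the effect on always-responders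
   integrates Y over an event of the same mu_x-mass, and the basic bound
   integrates Y over the tail of mu_x cut at a common point t.  Both comparisons
   are instances of the bathtub principle applied to each mu_x: among the
   measurable sets A, the tail cut at c is extremal for
   int_A Y dmu_x - c mu_x(A). *)

(** * Measurability of integrals over sections *)

Section xsection_kernel.
Context dX dW (X : measurableType dX) (W : measurableType dW) (R : realType).
Variable k : R.-fker X ~> W.

(** Restricting [f \o snd] to [G] replaces a domain that moves with x by a fixed integrand on the
    product, which a finite kernel integrates measurably. *)
Lemma measurable_ge0_integral_xsection (G : set (X * W)) (f : W -> \bar R) :
  measurable G -> (forall v, 0 <= f v)%E -> measurable_fun setT f ->
  measurable_fun setT (fun x => \int[k x]_(v in xsection G x) f v)%E.
Proof.
move=> mG f0 mf; pose h := (f \o snd) \_ G.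
rewrite (_ : (fun x => _) = (fun x => \int[k x]_v h (x, v)))%E; last first.
  apply/funext => x; rewrite integral_mkcond; apply: eq_integral => v _.
  by rewrite /h !patchE mem_xsection.
apply: measurable_fun_integral_finite_kernel.
- by move=> z; rewrite /h; apply: erestrict_ge0 => z' _ /=; exact: f0.
- apply/(measurable_restrictT _ _).1 => //; apply: measurable_funTS.
  exact: measurableT_comp.
Qed.

(** The real integral is [fine] of a difference of two nonnegative integrals, hence measurable in x
    even across points where [f] is not integrable. *)
Lemma measurable_Rintegral_xsection (G : set (X * W)) (f : W -> R) :
  measurable G -> measurable_fun setT f ->
  measurable_fun setT (fun x => \int[k x]_(v in xsection G x) f v).
Proof.
move=> mG mf; apply: measurableT_comp => //.
under eq_fun do rewrite integralE.
have mEf : measurable_fun setT (EFin \o f) by exact/measurable_EFinP.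
apply: emeasurable_funB; apply: measurable_ge0_integral_xsection => //.
- exact: measurable_funepos.
- exact: measurable_funeneg.
Qed.

End xsection_kernel.

(** * Mixtures of measures *)

Section mixture.
Local Open Scope ereal_scope.
Context d1 d2 (X : measurableType d1) (V : measurableType d2) (R : realType).
Variables (F : {measure set X -> \bar R}) (l : X -> {measure set V -> \bar R}).
Variable nu : {measure set V -> \bar R}.
Hypothesis ml : forall A, measurable A -> measurable_fun setT (l ^~ A).
Hypothesis nuE : forall A, measurable A -> nu A = \int[F]_x l x A.

Import HBNNSimple.

Let measurable_integral (g : V -> \bar R) : (forall v, 0 <= g v) ->
  measurable_fun setT g -> measurable_fun setT (fun x => \int[l x]_v g v).
Proof. by move=> g0 mg; exact: measurable_fun_integral_kernel. Qed.

Let integral_mixture_nnsfun (g : {nnsfun V >-> R}) :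
  \int[nu]_v (g v)%:E = \int[F]_x \int[l x]_v (g v)%:E.
Proof.
have E (m : {measure set V -> \bar R}) : \int[m]_v (g v)%:E =
    \sum_(r \in range g) r%:E * m (g @^-1` [set r]).
  by rewrite integralT_nnsfun sintegralE.
rewrite E; under [RHS]eq_integral do rewrite E.
rewrite ge0_integral_fsum//.
- apply: eq_fsbigr => r _; rewrite nuE//.
  (* A negative r is not a value of [g]: its preimage is empty and its term vanishes on both
     sides. *)
  have [r0|r0] := leP 0%R r.
    by rewrite ge0_integralZl//; exact: ml.
  by rewrite preimage_nnfun0// !integral0_eq ?mule0// => x _;
    rewrite measure0 ?mule0.
- by move=> r; apply: measurable_funeM; exact: ml.
- move=> r x _; have [r0|r0] := leP 0%R r; first by rewrite mule_ge0.
  by rewrite preimage_nnfun0// measure0 mule0.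
Qed.

(** Simple functions are settled by linearity; monotone convergence, under [nu], under each [l x]
    and then under [F], carries the formula to the limit. *)
Lemma ge0_integral_mixture (g : V -> \bar R) : (forall v, 0 <= g v) ->
  measurable_fun setT g -> \int[nu]_v g v = \int[F]_x \int[l x]_v g v.
Proof.
move=> g0 mg; pose g_ := nnsfun_approx measurableT mg.
have E (m : {measure set V -> \bar R}) :
    \int[m]_v (g_ n v)%:E @[n --> \oo] --> \int[m]_v g v.
  rewrite [X in _ --> X](_ : _ = \int[m]_v limn (fun n => (g_ n v)%:E)).
    apply: cvg_monotone_convergence => //.
    - by move=> n; exact/measurable_EFinP.
    - by move=> n v _; rewrite lee_fin.
    - by move=> v _ i j ij; rewrite lee_fin; exact/lefP/nd_nnsfun_approx.
  apply: eq_integral => v _; apply/esym/cvg_lim => //.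
  exact: cvg_nnsfun_approx.
have /cvg_lim <-// := E nu.
transitivity (\int[F]_x limn (fun n => \int[l x]_v (g_ n v)%:E)); last first.
  by apply: eq_integral => x _; apply/cvg_lim => //; exact: E.
rewrite monotone_convergence//.
- by congr (limn _); apply/funext => n; exact: integral_mixture_nnsfun.
- move=> n; apply: measurable_integral; first by move=> v; rewrite lee_fin.
  exact/measurable_EFinP.
- by move=> n x _; apply: integral_ge0 => v _; rewrite lee_fin.
- move=> x _ i j ij; apply: ge0_le_integral => //.
  + by move=> v _; rewrite lee_fin.
  + exact/measurable_EFinP.
  + exact/measurable_EFinP.
  + by move=> v _; rewrite lee_fin; exact/lefP/nd_nnsfun_approx.
Qed.

End mixture.

Section weighted_mixture.
Local Open Scope ereal_scope.
Context dX dW dV (X : measurableType dX) (W : measurableType dW)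
  (V : measurableType dV) (R : realType).
Variables (F : {measure set X -> \bar R}) (k : R.-ker X ~> W).
Variables (w : X -> R) (C : set W) (phi : W -> V).
Variable nu : {measure set V -> \bar R}.
Hypotheses (w0 : forall x, (0 <= w x)%R) (mw : measurable_fun setT w).
Hypotheses (mC : measurable C) (mphi : measurable_fun setT phi).
Hypothesis nuE : forall A, measurable A ->
  nu A = \int[F]_x ((w x)%:E * k x (C `&` phi @^-1` A)).

Let mphiA A : measurable A -> measurable (phi @^-1` A).
Proof. by move=> mA; rewrite -[X in measurable X]setTI; exact: mphi. Qed.

Lemma measurable_ge0_integral_section (g : W -> \bar R) :
  (forall v, 0 <= g v) -> measurable_fun setT g ->
  measurable_fun setT (fun x => \int[k x]_(v in C) g v).
Proof.
move=> g0 mg; under eq_fun do rewrite integral_mkcond.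
apply: measurable_fun_integral_kernel.
- by move=> A mA; exact: measurable_kernel.
- by move=> v; rewrite erestrict_ge0.
- apply/(measurable_restrictT _ _).1 => //.
  exact: measurable_funTS.
Qed.

(** [nu] is a mixture of the measures obtained from [k x] by restricting to [C], pushing forward
    along [phi] and scaling by [w x]. *)
Lemma ge0_integral_weighted_mixture (g : V -> \bar R) :
  (forall v, 0 <= g v) -> measurable_fun setT g ->
  \int[nu]_v g v = \int[F]_x ((w x)%:E * \int[k x]_(v in C) g (phi v)).
Proof.
move=> g0 mg.
pose m x : {measure set W -> \bar R} := mrestr (k x) mC.
pose p x : {measure set V -> \bar R} := pushforward (m x) phi.
pose l x : {measure set V -> \bar R} := mscale (NngNum (w0 x)) (p mphi x).
have lE A x : l x A = (w x)%:E * k x (C `&` phi @^-1` A) by rewrite setIC.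
have ml A : measurable A -> measurable_fun setT (l ^~ A).
  move=> mA; under eq_fun do rewrite lE; apply: emeasurable_funM.
    exact/measurable_EFinP.
  by apply: measurable_kernel; apply: measurableI => //; exact: mphiA.
rewrite (@ge0_integral_mixture _ _ _ _ _ F l nu) //.
  apply: eq_integral => x _; rewrite ge0_integral_mscale//; congr (_ * _).
  rewrite ge0_integral_pushforward// preimage_setT.
  have mgp : measurable_fun setT (g \o phi) by exact: measurableT_comp.
  (* The complement of [C] is null for the restricted measure, and inside [C] that measure agrees
     with [k x]. *)
  rewrite (@ge0_negligible_integral _ _ _ _ _ (~` C))//.
  - rewrite setTD setCK; apply: eq_measure_integral => A mA AC.
    by rewrite /m /= /mrestr setIidl.
  - exact: measurableC.
  - by move=> v _; exact: g0.
  - by rewrite /m /= /mrestr setICl measure0.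
move=> A mA; rewrite nuE//; apply: eq_integral => x _.
by rewrite lE.
Qed.

End weighted_mixture.

Lemma ae_eq_integrable d (T : measurableType d) (R : realType)
    (mu : {measure set T -> \bar R}) (f g : T -> \bar R) :
  measurable_fun setT g -> mu.-integrable setT f ->
  {ae mu, forall x, setT x -> f x = g x} -> mu.-integrable setT g.
Proof.
move=> mg /integrableP[mf fy] fg; apply/integrableP; split=> //.
rewrite -(ge0_ae_eq_integral (f := abse \o f))//.
- exact: measurableT_comp.
- exact: measurableT_comp.
- by move=> x _; exact: abse_ge0.
- exact: ae_eq_abse.
Qed.

Section signed_weighted_mixture.
Context dX dW dV (X : measurableType dX) (W : measurableType dW)
  (V : measurableType dV) (R : realType).
Variables (F : {measure set X -> \bar R}) (k : R.-fker X ~> W).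
Variables (w : X -> R) (C : set W) (phi : W -> V).
Variable nu : {measure set V -> \bar R}.
Hypotheses (w0 : forall x, 0 <= w x) (mw : measurable_fun setT w).
Hypotheses (mC : measurable C) (mphi : measurable_fun setT phi).
Hypothesis wgt0 : {ae F, forall x, 0 < w x}.
Hypothesis nuE : forall A, measurable A ->
  (nu A = \int[F]_x ((w x)%:E * k x (C `&` phi @^-1` A)))%E.
Variable g : V -> R.
Hypotheses (mg : measurable_fun setT g) (ig : nu.-integrable setT (EFin \o g)).

Let h (f : V -> \bar R) x := ((w x)%:E * \int[k x]_(v in C) f (phi v))%E.

Let h_ge0 f : (forall v, 0 <= f v)%E -> forall x, (0 <= h f x)%E.
Proof. by move=> f0 x; rewrite mule_ge0 ?lee_fin// integral_ge0. Qed.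

Let mh f : (forall v, 0 <= f v)%E -> measurable_fun setT f ->
  measurable_fun setT (h f).
Proof.
move=> f0 mf; apply: emeasurable_funM; first exact/measurable_EFinP.
apply: (measurable_ge0_integral_section _ mC) => //; exact: measurableT_comp.
Qed.

Let hE f : (forall v, 0 <= f v)%E -> measurable_fun setT f ->
  (\int[nu]_v f v = \int[F]_x h f x)%E.
Proof.
by move=> f0 mf; rewrite (ge0_integral_weighted_mixture w0 mw mC mphi nuE).
Qed.

Let integrable_h f : (forall v, 0 <= f v)%E -> nu.-integrable setT f ->
  F.-integrable setT (h f).
Proof.
move=> f0 /integrableP[mf fy]; apply/integrableP; split; first exact: mh.
under eq_integral do rewrite gee0_abs ?h_ge0//.
rewrite -hE//; apply: le_lt_trans fy; apply: ge0_le_integral => //.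
  exact: measurableT_comp.
by move=> v _; rewrite gee0_abs.
Qed.

(** The weighted sections of |g| have a finite integral, so almost all of them are finite; dividing
    by [w x > 0] leaves a finite integral under [k x]. *)
Lemma ae_integrable_weighted_mixture :
  {ae F, forall x, (k x).-integrable C (EFin \o g \o phi)}.
Proof.
have /integrable_ae : F.-integrable setT (h (abse \o (EFin \o g))).
  apply: integrable_h; first by move=> v; exact: abse_ge0.
  exact: integrable_abse.
move=> /(_ measurableT); apply: filterS2 wgt0 => x wx /(_ I) hx.
apply/integrableP; split.
  by apply: measurable_funTS; apply: measurableT_comp => //; exact/measurable_EFinP.
rewrite -ge0_fin_numE ?integral_ge0//; move: hx.
rewrite /h; set J := (\int[k x]_(v in C) _)%E => hx.
have -> : J = ((w x)^-1%:E * ((w x)%:E * J))%E.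
  by rewrite muleA -EFinM mulVf ?gt_eqF// mul1e.
by rewrite fin_numM.
Qed.

Definition weighted_section x : R := w x * \int[k x]_(v in C) g (phi v).

Let gp := (EFin \o g)^\+%E.
Let gn := (EFin \o g)^\-%E.

Let ihp : F.-integrable setT (h gp).
Proof.
by apply: integrable_h; [exact: funepos_ge0|exact: integrable_funepos].
Qed.

Let ihn : F.-integrable setT (h gn).
Proof.
by apply: integrable_h; [exact: funeneg_ge0|exact: integrable_funeneg].
Qed.

Let mgE : measurable_fun setT (EFin \o g).
Proof. exact/measurable_EFinP. Qed.

(** Only almost everywhere: where [g \o phi] is not integrable under [k x], [fine] may return a
    default value unrelated to the two parts. *)
Let weighted_sectionE :
  {ae F, forall x, setT x -> (h gp x - h gn x)%E = (weighted_section x)%:E}.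
Proof.
apply: filterS ae_integrable_weighted_mixture => x ix _.
have fp := integrable_pos_fin_num mC ix.
have fn := integrable_neg_fin_num mC ix.
rewrite /weighted_section EFinM /Rintegral fineK; last first.
  exact: integrable_fin_num.
rewrite [in RHS]integralE muleBr//; last exact: fin_num_adde_defr.
by congr (_ * _ - _ * _)%E; apply: eq_integral => v _;
  rewrite /gp /gn ?funeposE ?funenegE.
Qed.

Let m_weighted_section : measurable_fun setT (EFin \o weighted_section).
Proof.
apply/measurable_EFinP/measurable_funM => //.
rewrite (_ : (fun x => _) =
  fun x => \int[k x]_(v in xsection (setT `*` C) x) (g \o phi) v).
  apply: measurable_Rintegral_xsection; first exact: measurableX.
  exact: measurableT_comp.
by apply/funext => x; rewrite in_xsectionX ?inE.
Qed.

Lemma integrable_weighted_section :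
  F.-integrable setT (EFin \o weighted_section).
Proof. exact: ae_eq_integrable (integrableB _ ihp ihn) weighted_sectionE. Qed.

(** The nonnegative formula is applied to the positive and negative parts of [g], whose sections
    recombine almost everywhere. *)
Lemma Rintegral_weighted_mixture :
  \int[nu]_v g v = \int[F]_x weighted_section x.
Proof.
congr fine; rewrite -(ae_eq_integral _ _ _ _ _ weighted_sectionE)//; last first.
  exact: measurable_int (integrableB _ ihp ihn).
rewrite integralB// [LHS]integralE -!hE//.
- exact: funeneg_ge0.
- exact: measurable_funeneg.
- exact: funepos_ge0.
- exact: measurable_funepos.
Qed.

End signed_weighted_mixture.

(** * Quantile trimming of an atomless variable *)

Section monotone_limits.
Local Open Scope ereal_scope.
Context d (T : measurableType d) (R : realType).
Variables (mu : {measure set T -> \bar R}) (E : (set T)^nat) (a : \bar R).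
Hypothesis mE : forall n, measurable (E n).

Lemma measure_bigcup_le : nondecreasing_seq E -> (forall n, mu (E n) <= a) ->
  mu (\bigcup_n E n) <= a.
Proof.
move=> ndE Ea; apply: cvge_le (nondecreasing_cvg_mu mE _ ndE).
  by apply: nearW => n; exact: Ea.
exact: bigcup_measurable.
Qed.

Lemma measure_bigcap_ge : nonincreasing_seq E -> mu (E 0%N) < +oo ->
  (forall n, a <= mu (E n)) -> a <= mu (\bigcap_n E n).
Proof.
move=> niE E0 Ea; apply: cvge_to_ge (nonincreasing_cvg_mu E0 mE _ niE) _.
  exact: bigcap_measurable.
by apply: nearW => n; exact: Ea.
Qed.

End monotone_limits.

Section trimming_side.
Context {R : realType}.

(* [true] stands for the lower bound, which keeps the left tail, and [false] for
   the upper bound, which keeps the right tail. *)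
Definition side (b : bool) (c : R) : set R :=
  if b then [set y | y <= c] else [set y | c <= y].

(** A right tail of mass u begins at the quantile of order 1 - u. *)
Definition level (b : bool) (u : R) : R := if b then u else 1 - u.

(** Multiplying by this sign reverses inequalities for the upper bound, so that each comparison is
    proved once for both sides. *)
Definition sgb (b : bool) : R := if b then 1 else -1.

Lemma measurable_side b c : measurable (side b c).
Proof.
case: b; rewrite /side.
  by rewrite -set_itvNyc; exact: measurable_itv.
by rewrite -set_itvcy; exact: measurable_itv.
Qed.

End trimming_side.

Section quantile_level.
Context d (T : measurableType d) (R : realType).
Variables (mu : {measure set T -> \bar R}) (C : set T) (f : T -> R).
Hypotheses (mC : measurable C) (muC : (0 < mu C < +oo)%E).
Hypothesis mf : measurable_fun setT f.
Hypothesis atomless : forall y, mu (C `&` f @^-1` [set y]) = 0%E.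

Let mfA (A : set R) : measurable A -> measurable (C `&` f @^-1` A).
Proof.
move=> mA; apply: measurableI => //.
by rewrite -[X in measurable X]setTI; exact: mf.
Qed.

Let mu_fin A : measurable A -> A `<=` C -> mu A \is a fin_num.
Proof.
move=> mA AC; case/andP: muC => _ Cy; rewrite ge0_fin_numE//.
by apply: le_lt_trans Cy; rewrite le_measure ?inE.
Qed.

Let mC0 : 0 < fine (mu C).
Proof. exact: fine_gt0. Qed.

Let G (y : R) := mu (C `&` f @^-1` `]-oo, y]).

Let H (y : R) : R := cond_prob mu [set v | f v <= y] C.

Let HG u y : (u <= H y) = ((u * fine (mu C))%:E <= G y)%E.
Proof.
rewrite /H /cond_prob ler_pdivlMr// setIC -lee_fin.
have -> : [set v | f v <= y] = f @^-1` `]-oo, y].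
  by apply/seteqP; split => v /=; rewrite in_itv.
by rewrite fineK//; apply: mu_fin; [exact: mfA|exact: subIsetl].
Qed.

Let G_nd : {homo G : x y / x <= y >-> (x <= y)%E}.
Proof.
move=> x y xy; rewrite le_measure ?inE; [by []|exact: mfA|exact: mfA|].
by apply: setIS; apply: preimage_subset; exact: subitvPr.
Qed.

Section interior_level.
Variable u : R.
Hypothesis u01 : 0 < u < 1.

Let q := (u * fine (mu C))%:E.

Let q_gt0 : (0 < q)%E.
Proof. by case/andP : u01 => u0 _; rewrite lte_fin mulr_gt0. Qed.

Let q_lt : (q < mu C)%E.
Proof.
case/andP : u01 => _ u1; rewrite -[mu C]fineK; last exact: mu_fin.
by rewrite lte_fin gtr_pMl.
Qed.

(** If no point reached level u, continuity from below would give mu C <= q; if the level set were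
    unbounded below, continuity from above would give q <= 0. Both contradict 0 < q < mu C. *)
Let has_inf_level : has_inf [set y | u <= H y].
Proof.
split.
  apply: contrapT => no.
  have : (mu (\bigcup_n (C `&` f @^-1` `]-oo, n%:R])) <= q)%E.
    apply: measure_bigcup_le.
    - by move=> n; exact: mfA.
    - move=> i j ij; apply/subsetPset; apply: setIS => v /=.
      by rewrite !in_itv/= => /le_trans; apply; rewrite ler_nat.
    - move=> n; rewrite leNgt; apply/negP => /ltW; rewrite -HG => un.
      by apply: no; exists n%:R.
  apply/negP; rewrite -ltNge -setI_bigcupr -preimage_bigcup.
  rewrite (_ : \bigcup_n _ = setT) ?preimage_setT ?setIT//.
  rewrite -subTset => y _; exists (Num.truncn y).+1 => //=.
  by rewrite in_itv/= ltW// truncnS_gt.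
apply: contrapT => no.
have : (q <= mu (\bigcap_n (C `&` f @^-1` `]-oo, (- n%:R)%R])))%E.
  apply: measure_bigcap_ge.
  - by move=> n; exact: mfA.
  - move=> i j ij; apply/subsetPset; apply: setIS => v /=.
    by rewrite !in_itv/= => /le_trans; apply; rewrite lerN2 ler_nat.
  - by rewrite -ge0_fin_numE// mu_fin//; exact: mfA.
  - move=> n; rewrite leNgt; apply/negP => Gn; apply: no.
    exists (- n%:R) => y /=; rewrite HG => Gy; rewrite leNgt; apply/negP => yn.
    by have := le_trans Gy (G_nd (ltW yn)); rewrite leNgt Gn.
apply/negP; rewrite -ltNge bigcapIr; last by exists 0%N.
rewrite (_ : \bigcap_n _ = set0) ?setI0 ?measure0//.
rewrite -subset0 => v /(_ (Num.truncn (- f v)).+1 I) /=.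
by rewrite in_itv/= leNgt ltrNl truncnS_gt.
Qed.

(** Right continuity gives q as a lower bound, since points just above the infimum reach the level.
    Points strictly below it do not, so the left limit is at most q, and the jump at the quantile is
    zero because there are no atoms. *)
Lemma quantile_cdf : G (quantile H u) = q.
Proof.
set c := quantile H u.
apply/eqP; rewrite eq_le; apply/andP; split; last first.
  rewrite /G (itvNycEbigcap false) preimage_bigcap -bigcapIr; last by exists 0%N.
  apply: measure_bigcap_ge.
  - by move=> n; exact: mfA.
  - move=> i j ij; apply/subsetPset; apply: setIS => v /=.
    rewrite !in_itv/= => /le_trans; apply.
    by rewrite lerD2l lef_pV2 ?posrE// ler_nat.
  - by rewrite -ge0_fin_numE// mu_fin//; exact: mfA.
  - move=> n.
    have [|y + yc] := @inf_lt _ [set y | u <= H y] (c + n.+1%:R^-1) has_inf_level.1.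
      by rewrite ltrDl invr_gt0.
    by rewrite /= HG => /le_trans; apply; rewrite G_nd// ltW.
have -> : G c = (mu (C `&` f @^-1` `]-oo, c[))%E.
  rewrite /G -(@setUitv1 _ _ -oo%O c true)//= preimage_setU setIUr.
  rewrite measureU//; last 3 first.
  - exact: mfA.
  - exact: mfA.
  - rewrite -subset0 => v /= -[[_]]; rewrite in_itv/= => /[swap] -[_ ->].
    by rewrite ltxx.
  by rewrite [X in (_ + X)%E](atomless c) adde0.
have -> : `]-oo, c[%classic = \bigcup_n `]-oo, c - n.+1%:R^-1]%classic.
  apply/seteqP; split => y /=; rewrite in_itv/=.
    move=> /ltr_add_invr[n yc]; exists n => //=.
    by rewrite in_itv/= lerBrDr ltW.
  move=> [n _ /=]; rewrite in_itv/= => /le_lt_trans; apply.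
  by rewrite ltrBlDr ltrDl invr_gt0.
rewrite preimage_bigcup setI_bigcupr; apply: measure_bigcup_le.
- by move=> n; exact: mfA.
- move=> i j ij; apply/subsetPset; apply: setIS => v /=.
  rewrite !in_itv/= => /le_trans; apply.
  by rewrite lerD2l lerN2 lef_pV2 ?posrE// ler_nat.
- move=> n; rewrite leNgt; apply/negP => /ltW; rewrite -HG => un.
  have := ge_inf has_inf_level.2 un; apply/negP; rewrite -ltNge.
  by rewrite ltrBlDr ltrDl invr_gt0.
Qed.

End interior_level.

Lemma quantile_level b (u : R) : 0 < u < 1 ->
  fine (mu (C `&` f @^-1` side b (quantile H (level b u)))) = u * fine (mu C).
Proof.
move=> u01; case: b; rewrite /side /level.
  by rewrite -set_itvNyc -/(G _) quantile_cdf.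
have u01' : 0 < 1 - u < 1.
  by case/andP : u01 => u0 u1; rewrite subr_gt0 u1 ltrBlDr ltrDl.
set c := quantile H (1 - u).
(* The right tail is the complement of the left one up to the point c, which carries no mass. *)
have -> : C `&` f @^-1` [set y | c <= y] =
    (C `\` C `&` f @^-1` `]-oo, c]) `|` (C `&` f @^-1` [set c]).
  apply/seteqP; split => v /=.
    move=> [Cv cv]; have [fc|fc] := leP (f v) c.
      by right; split => //; apply/le_anti; rewrite fc.
    by left; split => // -[_] /=; rewrite in_itv/= leNgt fc.
  move=> [[Cv nfc]|[Cv ->]]; split => //.
  by apply/ltW; rewrite ltNge; apply/negP => fc; apply: nfc; rewrite in_itv.
rewrite measureU0 ?atomless//; [|by apply: measurableD => //; exact: mfA|exact: mfA].
rewrite measureD//; last 2 first.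
- exact: mfA.
- by case/andP : muC.
rewrite setIA setIid [X in (_ - X)%E](quantile_cdf u01') fineB//; last exact: mu_fin.
by rewrite /= mulrBl mul1r opprB addrC subrK.
Qed.

End quantile_level.

Section trimmed_mean.
Context d (T : measurableType d) (R : realType).
Variables (mu : {measure set T -> \bar R}) (C : set T) (f : T -> R).
Hypotheses (mC : measurable C) (muC : (mu C < +oo)%E).
Hypothesis mf : measurable_fun setT f.
Hypothesis intf : mu.-integrable C (EFin \o f).

Local Notation m A := (fine (mu A)).

Let mfA (A : set R) : measurable A -> measurable (C `&` f @^-1` A).
Proof.
move=> mA; apply: measurableI => //.
by rewrite -[X in measurable X]setTI; exact: mf.
Qed.

Let mu_fin A : measurable A -> A `<=` C -> mu A \is a fin_num.
Proof.
move=> mA AC; rewrite ge0_fin_numE//.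
by apply: le_lt_trans muC; rewrite le_measure ?inE.
Qed.

Let intc B c : measurable B -> B `<=` C -> mu.-integrable B (EFin \o cst c).
Proof.
move=> mB BC; apply/integrableP; split; first exact/measurable_EFinP.
rewrite (eq_integral (cst `|c|%:E))// integral_cst// lte_mul_pinfty//.
by rewrite -ge0_fin_numE// mu_fin.
Qed.

Let intfB B : measurable B -> B `<=` C -> mu.-integrable B (EFin \o f).
Proof. by move=> mB BC; exact: integrableS intf. Qed.

(** Brings different sets to the common domain [C], where their integrands can be compared
    pointwise. *)
Let RintegralBcst B c : measurable B -> B `<=` C ->
  \int[mu]_(v in B) f v - c * m B = \int[mu]_(v in C) ((fun v => f v - c) \_ B) v.
Proof.
move=> mB BC; rewrite -Rintegral_mkcondr (setIidr BC) (RintegralB mB).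
- by rewrite Rintegral_cst.
- exact: intfB.
- exact: intc.
Qed.

(* Pointwise, (f - c) times the indicator of A is extremal because A is exactly
   the part of C where f - c has the sign selected by b. *)
Lemma bathtub b c B (A := C `&` f @^-1` side b c) : measurable B -> B `<=` C ->
  sgb b * (\int[mu]_(v in A) f v - c * m A) <=
  sgb b * (\int[mu]_(v in B) f v - c * m B).
Proof.
move=> mB BC.
have mA : measurable A by apply: mfA; exact: measurable_side.
have AC : A `<=` C by exact: subIsetl.
rewrite !RintegralBcst//.
have intp E : measurable E -> E `<=` C ->
    mu.-integrable C (EFin \o ((fun v => f v - c) \_ E)).
  move=> mE EC; rewrite -restrict_EFin.
  apply/(integrable_mkcond _ mC); rewrite -patch_setI (setIidr EC).
  apply/(integrable_mkcond _ mE).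
  have H := integrableB mE (intfB mE EC) (intc c mE EC); exact H.
have ineq v : C v -> sgb b * ((fun v => f v - c) \_ A) v <=
    sgb b * ((fun v => f v - c) \_ B) v.
  move=> Cv; rewrite !patchE /A in_setI (mem_set Cv)/=.
  have -> : (v \in f @^-1` side b c) = if b then f v <= c else c <= f v.
    by apply/idP/idP; rewrite inE; case: (b).
  case: (b); rewrite /sgb ?mul1r ?mulN1r ?lerN2.
    by have [|] := leP (f v) c => fc; case: ifP => _;
      rewrite ?subr_le0 ?subr_ge0// ltW.
  by have [|] := leP c (f v) => fc; case: ifP => _;
    rewrite ?subr_le0 ?subr_ge0// ltW.
rewrite -!RintegralZl//; try exact: intp.
apply: le_Rintegral => //.
- exact: integrableZl (intp _ mA AC).
- exact: integrableZl (intp _ mB BC).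
Qed.

(** The trimmed mean times the mass of [B] is an integral over a set [A] of that same mass: the tail
    when 0 < u < 1, the whole of [C] when nothing is trimmed, the empty set when [B] is null. With
    equal masses the terms in c of [bathtub] cancel. *)
Lemma trimmed_mean b B : measurable B -> B `<=` C ->
  ((0 < mu C)%E -> forall y, mu (C `&` f @^-1` [set y]) = 0%E) ->
  let u := m B / m C in
  let E := if u == 1 then C else C `&` f @^-1`
    side b (quantile (fun y => cond_prob mu [set v | f v <= y] C) (level b u)) in
  let t := cond_mean mu f E * m B in
  exists A, [/\ measurable A, A `<=` C, m A = m B, t = \int[mu]_(v in A) f v &
    sgb b * t <= sgb b * \int[mu]_(v in B) f v /\
    (m B = m C -> t = \int[mu]_(v in C) f v)].
Proof.
move=> mB BC atomless u E t.
have mBC : m B <= m C by rewrite fine_le ?mu_fin// le_measure ?inE.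
(* Here u = 0 and the quantile has no meaning, but the factor [m B = 0] makes t zero whatever the
   conditional mean is. *)
have [B0|B0] := eqVneq (m B) 0.
  have muB0 : mu B = 0%E by rewrite -[mu B]fineK ?B0// mu_fin.
  have intB0 : \int[mu]_(v in B) f v = 0.
    rewrite /Rintegral null_set_integral//.
    by apply/measurable_EFinP; exact: measurable_funTS.
  exists set0; split => //.
  - by rewrite measure0 B0.
  - by rewrite /t B0 mulr0 Rintegral_set0.
  - rewrite /t B0 mulr0 intB0; split => // C0.
    rewrite /Rintegral null_set_integral//.
      by apply/measurable_EFinP; exact: measurable_funTS.
    by rewrite -[mu C]fineK -?C0// mu_fin.
have mC0 : 0 < m C by rewrite (lt_le_trans _ mBC)// lt_neqAle eq_sym B0 fine_ge0.
(* No trimming: t is the integral over [C], equal to that over [B] because the difference is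
   null. *)
have [BeC|BneC] := eqVneq (m B) (m C).
  have tC : t = \int[mu]_(v in C) f v.
    have u1 : u = 1 by rewrite /u BeC divff// gt_eqF.
    by rewrite /t /E u1 eqxx BeC /cond_mean divfK// gt_eqF.
  exists C; split => //; split => //; rewrite tC.
  rewrite /Rintegral (@negligible_integral _ _ _ _ _ (C `\` B))//.
  - by rewrite setDD (setIidr BC).
  - exact: measurableD.
  - have muBC : mu B = mu C by rewrite -[mu B]fineK ?BeC ?fineK ?mu_fin.
    by rewrite measureD// (setIidr BC); move: muBC => /= ->; rewrite subee// mu_fin.
have u01 : 0 < u < 1.
  rewrite /u divr_gt0//=; last by rewrite lt_neqAle eq_sym B0 fine_ge0.
  by rewrite ltr_pdivrMr// mul1r lt_neqAle BneC.
have muC01 : (0 < mu C < +oo)%E.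
  by rewrite muC -[mu C]fineK ?mu_fin// lte_fin mC0.
have EE : E = C `&` f @^-1` side b
    (quantile (fun y => cond_prob mu [set v | f v <= y] C) (level b u)).
  by rewrite /E lt_eqF//; case/andP : u01.
have mE : m E = m B.
  rewrite EE quantile_level//.
    by rewrite /u divfK// gt_eqF.
  by apply: atomless; case/andP : muC01.
have tE : t = \int[mu]_(v in E) f v by rewrite /t /cond_mean mE divfK.
exists E; split => //.
- by rewrite EE; apply: mfA; exact: measurable_side.
- by rewrite EE; exact: subIsetl.
- split; last by move/eqP; rewrite (negbTE BneC).
  rewrite tE; set c := quantile _ _ in EE.
  have := @bathtub b c B mB BC; rewrite /= -EE mE.
  by rewrite !mulrBr lerD2r.
Qed.

End trimmed_mean.

(* Unlike [inf], the extended infimum needs no case distinction, and the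
   conventions [inf set0 = 0] and [fine (+oo) = fine (-oo) = 0] agree. *)
Lemma fine_ereal_inf (R : realType) (S : set R) :
  fine (ereal_inf [set y%:E | y in S]) = inf S.
Proof.
have [->|/set0P S0] := eqVneq S set0.
  by rewrite image_set0 ereal_inf0 inf0.
have [lS|nlS] := pselect (has_lbound S); first by rewrite ereal_inf_EFin.
rewrite inf_out; last by case.
have le_all M : (ereal_inf [set y%:E | y in S] <= M%:E)%E.
  apply: ge_ereal_inf; apply: contrapT => noy; apply: nlS; exists M => y Sy.
  rewrite leNgt; apply/negP => yM; apply: noy; exists y%:E; first by exists y.
  by rewrite lee_fin ltW.
move: le_all; case: (ereal_inf _) => //= t /(_ (t - 1)).
by rewrite lee_fin lerBrDr gerDl ler10.
Qed.

(** * Measurable dependence of quantiles on a parameter *)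

Section measurable_quantile.
Context d (X : measurableType d) (R : realType).
Variables (H : X -> R -> R) (u : X -> R).
Hypotheses (H_nd : forall x, {homo H x : y z / y <= z}).
Hypotheses (mH : forall y, measurable_fun setT (H ^~ y)).
Hypothesis mu : measurable_fun setT u.

(** An enumeration of the rationals; a number coding no rational falls back on 0, itself a rational,
    so nothing foreign enters. *)
Let r (n : nat) : R := ratr (odflt 0 (unpickle n)).

Let e (n : nat) (x : X) : \bar R := if u x <= H x (r n) then (r n)%:E else +oo%E.

(** By monotonicity every rational above a point of the level set belongs to it, so the infimum may
    be taken over rationals. It becomes a countable infimum of measurable functions. *)
Let quantileE x : quantile (H x) (u x) = fine (einfs (e ^~ x) 0).
Proof.
rewrite /quantile -fine_ereal_inf; congr fine; apply/eqP; rewrite eq_le.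
apply/andP; split.
  apply: le_ereal_inf_tmp => _ [n _ <-]; rewrite /e.
  case: ifPn => [un|_]; last exact: leey.
  by apply: ereal_inf_lbound; exists (r n).
apply: le_ereal_inf_tmp => _ [y /= uy <-]; apply/lee_addgt0Pr => eps eps0.
have [q] : exists q : rat, ratr q \in `]y, (y + eps)[.
  by apply: rat_in_itvoo; rewrite ltrDl.
rewrite in_itv/= => /andP[yq qy].
apply: ge_ereal_inf; exists (ratr q : R)%:E; last by rewrite -EFinD lee_fin ltW.
exists (pickle q) => //; rewrite /e /r pickleK/= ifT//.
by rewrite (le_trans uy)// H_nd// ltW.
Qed.

Lemma measurable_quantile : measurable_fun setT (fun x => quantile (H x) (u x)).
Proof.
under eq_fun do rewrite quantileE.
apply: measurableT_comp => //; apply: measurable_fun_einfs => n.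
apply: measurable_fun_ifT => //; first exact: measurable_fun_ler.
Qed.

End measurable_quantile.

(** * Almost-everywhere comparison of real integrals *)

Section ae_Rintegral.
Context d (T : measurableType d) (R : realType).
Variable mu : {measure set T -> \bar R}.
Implicit Types f g : T -> R.

Lemma ae_eq_Rintegral f g :
  measurable_fun setT f -> measurable_fun setT g ->
  {ae mu, forall x, f x = g x} -> \int[mu]_x f x = \int[mu]_x g x.
Proof.
move=> mf mg fg; congr fine; apply: ae_eq_integral => //.
- exact/measurable_EFinP.
- exact/measurable_EFinP.
- by apply: filterS fg => x + _ => ->.
Qed.

Lemma ae_le_integrable f g : measurable_fun setT f ->
  mu.-integrable setT (EFin \o g) -> {ae mu, forall x, `|f x| <= g x} ->
  mu.-integrable setT (EFin \o f).
Proof.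
move=> mf ig fg.
have mEf : measurable_fun setT (EFin \o f) by exact/measurable_EFinP.
apply/integrableP; split => //.
have /integrableP[mg] := integrable_abse ig.
apply: le_lt_trans; apply: ae_ge0_le_integral => //.
- exact: measurableT_comp.
- exact: measurableT_comp.
- apply: filterS fg => x fgx _ /=; rewrite lee_fin normr_id.
  by rewrite (le_trans fgx)// ler_norm.
Qed.

Lemma ae_le_Rintegral f g :
  mu.-integrable setT (EFin \o f) -> mu.-integrable setT (EFin \o g) ->
  {ae mu, forall x, f x <= g x} -> \int[mu]_x f x <= \int[mu]_x g x.
Proof.
move=> If Ig fg.
have mf : measurable_fun setT f by apply/measurable_EFinP; case/integrableP: If.
have mg : measurable_fun setT g by apply/measurable_EFinP; case/integrableP: Ig.
(* The maximum equals [g] almost everywhere and dominates [f] everywhere. *)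
rewrite (ae_eq_Rintegral (g := fun x => Num.max (f x) (g x)) mg)//.
- apply: le_Rintegral => //; last by move=> x _; rewrite le_max lexx.
  apply: (@ae_eq_integrable _ _ _ _ (EFin \o g)) => //.
    by apply/measurable_EFinP; exact: measurable_maxr.
  by apply: filterS fg => x fgx _ /=; rewrite max_r.
- exact: measurable_maxr.
- by apply: filterS fg => x fgx /=; rewrite max_r.
Qed.

End ae_Rintegral.

(** * Conditional cells and inverse probability weights *)

Section conditional_cells.
Context {R : realType} {p : nat}.
Variable k : R.-pker (p.-tuple R) ~> (unit_data R).
Implicit Types (x : p.-tuple R) (a b : bool).

Definition arm a : set (unit_data R) := [set v | treat v = a].

(** The inverse propensity of the arm. *)
Definition weight a x : R := (fine (k x (arm a)))^-1.

(** The event S(0) = 1; inside [cell true], where S(1) = 1, it singles out the always-responders. *)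
Definition responds0 : set (unit_data R) := [set v | v.2.1.1 = true].

Lemma weight_ge0 a x : 0 <= weight a x.
Proof. by rewrite invr_ge0 fine_ge0. Qed.

Lemma measurable_weight a : measurable_fun setT (weight a).
Proof.
apply: (measurableT_comp (@measurable_invr R)).
by apply: measurableT_comp => //; apply: measurable_kernel;
  exact: measurable_treat_set.
Qed.

Lemma measurable_responds0 : measurable responds0.
Proof.
rewrite -[X in measurable X]setTI.
pose f (v : unit_data R) := v.2.1.1.
have mf : measurable_fun setT f.
  by do 2 apply: measurableT_comp => //; exact: measurable_snd.
exact: (mf measurableT [set true]).
Qed.

Lemma measurable_outcome_preimage (A : set R) :
  measurable A -> measurable (outcome @^-1` A : set (unit_data R)).
Proof.
by move=> mA; rewrite -[X in measurable X]setTI; exact: measurable_outcome.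
Qed.

Lemma resp_rateE a x : resp_rate k a x = weight a x * fine (k x (cell a)).
Proof. by rewrite /resp_rate /cond_prob setIC mulrC. Qed.

(** The mass of the cell cancels between the two factors; where it is zero, both sides are zero. *)
Lemma cond_prob_cellE x (A : set (unit_data R)) : measurable A ->
  cond_prob (k x) A (cell true) * resp_rate k true x =
  weight true x * fine (k x (cell true `&` A)).
Proof.
move=> mA; rewrite resp_rateE /cond_prob setIC.
have [C0|C0] := eqVneq (fine (k x (cell true))) 0.
  rewrite C0 !mulr0; suff -> : fine (k x (cell true `&` A)) = 0 by rewrite mulr0.
  apply/le_anti; rewrite fine_ge0// andbT -C0 fine_le ?kernel_fin_num//.
  - by apply: measurableI => //; exact: measurable_cell.
  - exact: measurable_cell.
  - rewrite le_measure ?inE//; last exact: measurable_cell.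
    by apply: measurableI => //; exact: measurable_cell.
by rewrite mulrCA divfK.
Qed.

(** Common form of [theta1L] (b = true) and [theta1U] (b = false). *)
Definition theta1 b x : R :=
  cond_mean (k x) outcome
    (if resp_ratio k x == 1 then cell true else cell true `&`
      outcome @^-1` side b (quantile (treated_cdf k x)
                                     (level b (resp_ratio k x)))).

Definition ctb_integrand b x : R := theta1 b x * resp_rate k false x.

Lemma treated_cdf_nd x : {homo treated_cdf k x : y z / y <= z}.
Proof.
move=> y z yz; rewrite /treated_cdf /cond_prob ler_wpM2r ?invr_ge0 ?fine_ge0//.
have m t : measurable ([set v : unit_data R | outcome v <= t] `&` cell true).
  apply: measurableI; last exact: measurable_cell.
  by rewrite -[X in measurable X](_ : outcome @^-1` side true t = _)//;
    apply: measurable_outcome_preimage; exact: measurable_side.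
rewrite fine_le ?kernel_fin_num// le_measure ?inE//.
by apply: setSI => v /= /le_trans; apply.
Qed.

Lemma measurable_resp_ratio : measurable_fun setT (resp_ratio k).
Proof.
apply: measurable_funM; first exact: measurable_resp_rate.
apply: (measurableT_comp (@measurable_invr R)); exact: measurable_resp_rate.
Qed.

Lemma measurable_trimming_point b : measurable_fun setT
  (fun x => quantile (treated_cdf k x) (level b (resp_ratio k x))).
Proof.
apply: measurable_quantile.
- exact: treated_cdf_nd.
- move=> y; apply: measurable_cond_prob; last exact: measurable_cell.
  by rewrite -[X in measurable X](_ : outcome @^-1` side true y = _)//;
    apply: measurable_outcome_preimage; exact: measurable_side.
- case: b; rewrite /level; first exact: measurable_resp_ratio.
  by apply: measurable_funB => //; exact: measurable_resp_ratio.
Qed.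

(** The trimmed set at x is the x-section of one measurable set [G] of the product, so both its mass
    and the integral over it are measurable in x. *)
Lemma measurable_ctb_integrand b : measurable_fun setT (ctb_integrand b).
Proof.
pose c x := quantile (treated_cdf k x) (level b (resp_ratio k x)).
have mc : measurable_fun setT c by exact: measurable_trimming_point.
pose in_side (z : p.-tuple R * unit_data R) : bool :=
  if b then outcome z.2 <= c z.1 else c z.1 <= outcome z.2.
have mo2 : measurable_fun setT (fun z : p.-tuple R * unit_data R => outcome z.2).
  exact: measurableT_comp measurable_outcome measurable_snd.
have mc1 : measurable_fun setT (fun z : p.-tuple R * unit_data R => c z.1).
  exact: measurableT_comp mc measurable_fst.
have mside : measurable_fun setT in_side.
  by rewrite /in_side; case: (b); exact: measurable_fun_ler.
have mu1 : measurable_fun setT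
    (fun z : p.-tuple R * unit_data R => resp_ratio k z.1 == 1).
  apply: measurable_fun_eqr => //.
  exact: measurableT_comp measurable_resp_ratio measurable_fst.
pose G : set (p.-tuple R * unit_data R) :=
  snd @^-1` cell true `&` [set z | (resp_ratio k z.1 == 1) || in_side z].
have mG : measurable G.
  apply: measurableI.
    by rewrite -[X in measurable X]setTI; apply: measurable_snd => //;
      exact: measurable_cell.
  rewrite -[X in measurable X]setTI.
  exact: (measurable_or mu1 mside measurableT (Y := [set true])).
have E x : (if resp_ratio k x == 1 then cell true else cell true `&`
    outcome @^-1` side b (c x)) = xsection G x.
  rewrite /xsection /G /in_side /side.
  case: ifP => u1; apply/seteqP; split => v /=; rewrite inE/= u1/=.
  - by [].
  - by case.
  - by case: (b).
  - by case: (b).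
apply: measurable_funM; last exact: measurable_resp_rate.
rewrite /theta1; under eq_fun do rewrite -/(c _) E /cond_mean.
apply: measurable_funM.
  by apply: measurable_Rintegral_xsection => //; exact: measurable_outcome.
apply: (measurableT_comp (@measurable_invr R)).
apply: measurableT_comp => //.
by apply: measurable_fun_xsection_finite_kernel; rewrite inE.
Qed.

End conditional_cells.

(** * Trimming at a fixed covariate value *)

Section ctb_pointwise.
Context {R : realType} {p : nat}.
Variables (k : R.-pker (p.-tuple R) ~> (unit_data R)) (x : p.-tuple R) (b : bool).
Local Notation w := (weight k true x).
Local Notation C := (cell true : set (unit_data R)).
Hypothesis w_gt0 : 0 < w.
Hypothesis rate0E :
  resp_rate k false x = w * fine (k x (C `&` responds0)).
Hypothesis int_outcome : (k x).-integrable C (EFin \o outcome).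
Hypothesis atomless : (0 < k x C)%E ->
  forall y, k x (C `&` outcome @^-1` [set y]) = 0%E.

Let mC : measurable C. Proof. exact: measurable_cell. Qed.

Let kC : (k x C < +oo)%E.
Proof. by rewrite -ge0_fin_numE// kernel_fin_num. Qed.

Let mB : measurable (C `&` responds0).
Proof. by apply: measurableI => //; exact: measurable_responds0. Qed.

(** The weight cancels in the ratio of response rates, which is therefore the share of
    always-responders in the treated cell; [trimmed_mean] applies with that subset as [B]. *)
Lemma ctb_integrand_trimmed : exists A, [/\ measurable A, A `<=` C,
  resp_rate k false x = w * fine (k x A),
  ctb_integrand k b x = w * \int[k x]_(v in A) outcome v &
  sgb b * ctb_integrand k b x <=
    sgb b * (w * \int[k x]_(v in C `&` responds0) outcome v) /\
  (resp_rate k false x = resp_rate k true x ->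
    ctb_integrand k b x = w * \int[k x]_(v in C) outcome v)].
Proof.
have uE : resp_ratio k x = fine (k x (C `&` responds0)) / fine (k x C).
  by rewrite /resp_ratio rate0E resp_rateE -mulf_div divff ?mul1r// gt_eqF.
have [A [mA AC mAB tA [tB tC]]] := trimmed_mean mC kC (@measurable_outcome R)
  int_outcome b mB (@subIsetl _ _ _) atomless.
have tE : ctb_integrand k b x = w *
    (cond_mean (k x) outcome (if resp_ratio k x == 1 then C else C `&`
      outcome @^-1` side b (quantile (treated_cdf k x)
                                     (level b (resp_ratio k x)))) *
    fine (k x (C `&` responds0))).
  by rewrite /ctb_integrand rate0E mulrCA.
rewrite -uE -/(treated_cdf k x) in tA tB tC.
exists A; split => //.
- by rewrite rate0E mAB.
- by rewrite tE tA.
- split; first by rewrite tE !(mulrCA _ w) ler_pM2l.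
  rewrite rate0E resp_rateE => /(mulfI (lt0r_neq0 w_gt0)) BC.
  by rewrite tE tC.
Qed.

(** The tail cut at an arbitrary c need not have mass q_0 x; the terms in c pay for the difference,
    which vanishes after integration when c is the quantile of G. *)
Lemma ctb_integrand_bathtub c (A := C `&` outcome @^-1` side b c) :
  sgb b * (w * \int[k x]_(v in A) outcome v - c * (w * fine (k x A))) <=
  sgb b * (ctb_integrand k b x - c * resp_rate k false x).
Proof.
have [A' [mA' A'C -> -> _]] := ctb_integrand_trimmed.
have := bathtub mC kC (@measurable_outcome R) int_outcome b c mA' A'C.
by rewrite -/A !(mulrCA c) -!mulrBr !(mulrCA (sgb b)) (ler_pM2l w_gt0).
Qed.

(** The trimmed set lies inside the cell; this domination will make the integrand integrable over
    x. *)
Lemma normr_ctb_integrand :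
  `|ctb_integrand k b x| <= w * \int[k x]_(v in C) `|outcome v|.
Proof.
have [A' [mA' A'C _ -> _]] := ctb_integrand_trimmed.
have iA' : (k x).-integrable A' (EFin \o outcome) by exact: integrableS int_outcome.
rewrite normrM (ger0_norm (ltW w_gt0)) (ler_pM2l w_gt0).
apply: le_trans (le_normr_Rintegral mA' iA') _.
have -> : \int[k x]_(t in A') `|outcome t| =
    \int[k x]_(t in C) ((fun v => `|outcome v|) \_ A') t.
  by rewrite -Rintegral_mkcondr (setIidr A'C).
apply: le_Rintegral => //.
- rewrite -restrict_EFin.
  apply/(integrable_mkcond _ mC); rewrite -patch_setI (setIidr A'C).
  by apply/(integrable_mkcond _ mA'); exact: integrable_norm.
- exact: integrable_norm.
- move=> v Cv; rewrite patchE; case: ifP => _ //; exact: normr_ge0.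
Qed.

End ctb_pointwise.

Lemma ae_cell_atomless (R : realType) (p : nat) (F : probability (p.-tuple R) R)
    (k : R.-pker (p.-tuple R) ~> (unit_data R)) :
  continuous_outcome F k -> {ae F, forall x, (0 < k x (cell true))%E ->
    forall y, k x (cell true `&` outcome @^-1` [set y]) = 0%E}.
Proof.
apply: filterS => x ctx C0 y.
have [f [mf f0 fE]] := ctx C0.
have mC : measurable (cell true : set (unit_data R)) by exact: measurable_cell.
have my : measurable (outcome @^-1` [set y] : set (unit_data R)).
  exact: measurable_outcome_preimage.
have := fE [set y] (measurable_set1 y); rewrite integral_set1.
(* The density gives a point probability 0. The quotient could also vanish through its denominator,
   which the positive mass of the cell excludes. *)
rewrite /cond_prob setIC => -[/eqP]; rewrite mulf_eq0 invr_eq0 => /orP[] /eqP h.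
  by rewrite -[LHS]fineK ?h// kernel_fin_num//; exact: measurableI.
by move: C0; rewrite -[k x _]fineK ?kernel_fin_num// h ltxx.
Qed.

(** * Potential variables and their observed cells *)

Section potentials.
Context {R : realType} d {Omega : measurableType d} {P : probability Omega R}.
Variables (S0 S1 : {RV P >-> bool}) (Y0 Y1 : {RV P >-> R}).

Definition potentials (o : Omega) : potential R :=
  ((S0 o, S1 o), (Y0 o, Y1 o)).

Lemma measurable_potentials : measurable_fun setT potentials.
Proof. by apply: measurable_fun_pair; apply: measurable_fun_pair. Qed.

HB.instance Definition _ :=
  isMeasurableFun.Build _ _ _ _ potentials measurable_potentials.

End potentials.

Section potential_cells.
Context {R : realType}.

Definition ever_responds (a : bool) : set (potential R) :=
  [set q | (if a then q.1.2 else q.1.1) = true].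

Definition always_responds : set (potential R) :=
  [set q | q.1.1 = true /\ q.1.2 = true].

Definition response (a : bool) (q : potential R) : R :=
  if a then q.2.2 else q.2.1.

Lemma measurable_response a : measurable_fun setT (response a).
Proof. by rewrite /response; case: a; apply: measurableT_comp. Qed.

Lemma measurable_ever_responds a : measurable (ever_responds a).
Proof.
rewrite -[X in measurable X]setTI.
have m : measurable_fun setT (fun q : potential R => if a then q.1.2 else q.1.1).
  by case: a; apply: measurableT_comp.
exact: (m measurableT [set true]).
Qed.

Lemma measurable_always_responds : measurable always_responds.
Proof.
rewrite (_ : always_responds = ever_responds false `&` ever_responds true)//.
by apply: measurableI; exact: measurable_ever_responds.
Qed.

Lemma measurable_arm_preimage a (A : set (potential R)) : measurable A ->
  measurable (arm a `&` snd @^-1` A : set (unit_data R)).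
Proof.
move=> mA; apply: measurableI; first exact: measurable_treat_set.
by rewrite -[X in measurable X]setTI; exact: measurable_snd.
Qed.

(** On arm a the observed response is S(a), which turns the cell into an event on potential
    variables, the kind ignorability speaks of. *)
Lemma cellE a : cell a = arm a `&` snd @^-1` ever_responds a :> set (unit_data R).
Proof.
by apply/seteqP; split => -[t q] /=; rewrite /cell/arm/ever_responds/resp/=;
  case=> ->.
Qed.

Lemma cell_responds0E : cell true `&` responds0 =
  arm true `&` snd @^-1` always_responds :> set (unit_data R).
Proof.
rewrite cellE; apply/seteqP; split => v /=.
  by move=> [[? ?] ?]; split => //; split.
by move=> [? [? ?]].
Qed.

Lemma Rintegral_arm (mu : {measure set (unit_data R) -> \bar R}) (h : R -> R) a
    (A : set (potential R)) :
  \int[mu]_(v in arm a) ((h \o response a) \_ A) v.2 =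
  \int[mu]_(v in arm a `&` snd @^-1` A) h (outcome v).
Proof.
rewrite Rintegral_mkcondr; apply: eq_Rintegral => v.
rewrite inE /arm/= => va; rewrite !patchE /response /outcome va.
have -> : (v \in snd @^-1` A) = (v.2 \in A) by apply/idP/idP; rewrite !inE.
by case: ifP => // _; case: (a).
Qed.

End potential_cells.

(** * Identification by inverse probability weighting *)

Section identification.
Context {R : realType} {p : nat} d {Omega : measurableType d}.
Variables (P : probability Omega R) (X : {RV P >-> p.-tuple R}).
Variables (D S0 S1 : {RV P >-> bool}) (Y0 Y1 : {RV P >-> R}).
Variable k : R.-pker (p.-tuple R) ~> (unit_data R).
Local Notation F := (distribution P X).
Hypothesis rcd : is_rcd X (joint D S0 S1 Y0 Y1) k.
Hypothesis ign : strong_ignorability F k.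
Local Notation pot := (potentials S0 S1 Y0 Y1).

Lemma marginal_law A : measurable A ->
  (P (pot @^-1` A) = \int[F]_x k x (snd @^-1` A))%E.
Proof.
move=> mA; have mA2 : measurable (snd @^-1` A : set (unit_data R)).
  by rewrite -[X in measurable X]setTI; exact: measurable_snd.
by rewrite -(rcd measurableT mA2) preimage_setT setTI.
Qed.

(** Overlap gives the treated arm mass above e, and its complement mass above e as well since the
    total mass is 1. *)
Lemma ae_weight_gt0 : {ae F, forall x, forall a, 0 < weight k a x}.
Proof.
case: ign => _ [e e0]; apply: filterS => x /andP[ek k1e] a.
have k0 : (0 < k x (arm true))%E by apply: lt_trans ek; rewrite lte_fin.
rewrite invr_gt0 fine_gt0//.
have ky b : (k x (arm b) < +oo)%E.
  by rewrite -ge0_fin_numE// kernel_fin_num//; exact: measurable_treat_set.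
rewrite ky andbT; case: a => //.
have -> : arm false = ~` arm true :> set (unit_data R).
  by apply/seteqP; split => -[[] q] /=; rewrite /arm/treat/=.
rewrite -setTD measureD ?setTI//; last 2 first.
- exact: measurable_treat_set.
- by rewrite -ge0_fin_numE// kernel_fin_num.
rewrite [X in (X - _)%E](prob_kernel x) sube_gt0 (lt_le_trans k1e)// lee_fin.
by rewrite gerBl ltW.
Qed.

(** Ignorability factors the joint mass, and the weight cancels the propensity. *)
Lemma ae_weight_arm a A : measurable A ->
  {ae F, forall x, ((weight k a x)%:E * k x (arm a `&` snd @^-1` A))%E =
                   k x (snd @^-1` A)}.
Proof.
move=> mA; case: ign => /(_ a A mA) + _.
apply: filterS2 ae_weight_gt0 => x /(_ a) w0 ->.
have kfin : k x (arm a) \is a fin_num.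
  by rewrite kernel_fin_num//; exact: measurable_treat_set.
rewrite muleA -[X in (_ * X * _)%E]fineK// -EFinM /weight mulVf ?mul1e//.
by move: w0; rewrite invr_gt0 => /lt0r_neq0.
Qed.

(** Exhibits the law of the potential variables as a weighted mixture over either arm, the form
    required by the mixture lemmas. *)
Lemma inverse_probability_law a A : measurable A ->
  (P (pot @^-1` A) =
   \int[F]_x ((weight k a x)%:E * k x (arm a `&` snd @^-1` A)))%E.
Proof.
move=> mA; have mA2 : measurable (snd @^-1` A : set (unit_data R)).
  by rewrite -[X in measurable X]setTI; exact: measurable_snd.
rewrite marginal_law//; apply: ae_eq_integral => //.
- exact: measurable_kernel.
- apply: emeasurable_funM.
    by apply/measurable_EFinP; exact: measurable_weight.
  by apply: measurable_kernel; exact: measurable_arm_preimage.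
- by apply: filterS (ae_weight_arm a mA) => x -> _.
Qed.

Section weighted_response.
Variables (a : bool) (h : R -> R).
Hypotheses (mh : measurable_fun setT h).
Hypothesis ih : P.-integrable setT (EFin \o (fun o => h (response a (pot o)))).
Variable A : set (potential R).
Hypothesis mA : measurable A.

Let g : potential R -> R := (h \o response a) \_ A.

Let mg : measurable_fun setT g.
Proof.
apply/(measurable_restrictT _ _).1 => //; apply: measurable_funTS.
by apply: measurableT_comp => //; exact: measurable_response.
Qed.

Let gpotE : EFin \o g \o pot =
  (EFin \o (fun o => h (response a (pot o)))) \_ (pot @^-1` A).
Proof.
rewrite restrict_EFin; apply/funext => o; rewrite /g /= !patchE.
by have -> : (o \in pot @^-1` A) = (pot o \in A) by apply/idP/idP; rewrite !inE.
Qed.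

Let mpotA : measurable (pot @^-1` A).
Proof. exact: measurable_funPTI. Qed.

Let igpot : P.-integrable setT (EFin \o g \o pot).
Proof.
rewrite gpotE; apply/(integrable_mkcond _ mpotA).
exact: integrableS ih.
Qed.

Let ig : (distribution P pot).-integrable setT (EFin \o g).
Proof.
apply: integrable_pushforward => //; exact/measurable_EFinP.
Qed.

Definition weighted_response x : R :=
  weight k a x * \int[k x]_(v in arm a `&` snd @^-1` A) h (outcome v).

Let wrE : weighted_section k (weight k a) (arm a) snd g = weighted_response.
Proof.
by apply/funext => x; rewrite /weighted_section /weighted_response Rintegral_arm.
Qed.

Let nuE B : measurable B -> (distribution P pot B =
  \int[F]_x ((weight k a x)%:E * k x (arm a `&` snd @^-1` B)))%E.
Proof. by move=> mB; rewrite -inverse_probability_law. Qed.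

Let wgt0 : {ae F, forall x, 0 < weight k a x}.
Proof. by apply: filterS ae_weight_gt0 => x; exact. Qed.

Lemma integrable_weighted_response :
  F.-integrable setT (EFin \o weighted_response).
Proof.
rewrite -wrE; apply: (@integrable_weighted_section _ _ _ _ _ _ _ F k
  (weight k a) (arm a) snd (distribution P pot)) => //.
- exact: weight_ge0.
- exact: measurable_weight.
- exact: measurable_treat_set.
Qed.

(** The mixture formula for [h \o response a] restricted to [A]; on arm a the potential outcome is
    the observed one. *)
Lemma Rintegral_weighted_response :
  \int[P]_(o in pot @^-1` A) h (response a (pot o)) =
  \int[F]_x weighted_response x.
Proof.
have <- : \int[distribution P pot]_q g q =
    \int[P]_(o in pot @^-1` A) h (response a (pot o)).
  congr fine; rewrite integral_distribution//; last exact/measurable_EFinP.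
  by rewrite [RHS]integral_mkcond gpotE.
rewrite -wrE; apply: (@Rintegral_weighted_mixture _ _ _ _ _ _ _ F k
  (weight k a) (arm a) snd (distribution P pot)) => //.
- exact: weight_ge0.
- exact: measurable_weight.
- exact: measurable_treat_set.
Qed.

End weighted_response.

Lemma ae_integrable_arm a :
  P.-integrable setT (EFin \o (fun o => response a (pot o))) ->
  {ae F, forall x, (k x).-integrable (cell a) (EFin \o outcome)}.
Proof.
move=> ir.
have /= : {ae F, forall x, (k x).-integrable (arm a)
    (EFin \o response a \o snd)}.
  apply: (@ae_integrable_weighted_mixture _ _ _ _ _ _ _ F k (weight k a) (arm a)
    snd (distribution P pot)).
  - exact: weight_ge0.
  - exact: measurable_weight.
  - exact: measurable_treat_set.
  - exact: measurable_snd.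
  - by apply: filterS ae_weight_gt0 => x; exact.
  - by move=> B mB; rewrite -inverse_probability_law.
  - exact: measurable_response.
  - apply: integrable_pushforward => //.
    by apply/measurable_EFinP; exact: measurable_response.
apply: filterS => x ix.
have mc : measurable (cell a : set (unit_data R)) by exact: measurable_cell.
have ca : (cell a : set (unit_data R)) `<=` arm a by move=> v [].
apply: eq_integrable (integrableS _ mc ca ix) => //; last first.
  exact: measurable_treat_set.
move=> v; rewrite inE => -[va _] /=; rewrite /response /outcome va.
by case: (a).
Qed.

End identification.

(** * Comparison of the bounds *)

Section basic_law.
Context {R : realType} {p : nat}.
Variables (F : probability (p.-tuple R) R)
          (k : R.-pker (p.-tuple R) ~> (unit_data R)).
Local Notation C := (cell true : set (unit_data R)).
Local Notation Q1 := (\int[F]_x resp_rate k true x).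

Lemma integrable_unit_interval (f : p.-tuple R -> R) : measurable_fun setT f ->
  (forall x, 0 <= f x <= 1) -> F.-integrable setT (EFin \o f).
Proof.
move=> mf f01; apply: (ae_le_integrable (g := cst 1)) => //.
  exact: finite_measure_integrable_cst.
by apply: aeW => x; case/andP: (f01 x) => f0 f1; rewrite ger0_norm.
Qed.

Lemma integrable_resp_rate a : F.-integrable setT (EFin \o resp_rate k a).
Proof.
apply: integrable_unit_interval; first exact: measurable_resp_rate.
move=> x; rewrite cond_prob_ge0 cond_prob_le1//.
- exact: measurable_resp_set.
- exact: measurable_treat_set.
Qed.

Lemma integrable_weight_cell (A : set (unit_data R)) : measurable A ->
  F.-integrable setT (EFin \o (fun x => weight k true x * fine (k x (C `&` A)))).
Proof.
move=> mA; have mCA : measurable (C `&` A).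
  by apply: measurableI => //; exact: measurable_cell.
apply: integrable_unit_interval.
  apply: measurable_funM; first exact: measurable_weight.
  by apply: measurableT_comp => //; exact: measurable_kernel.
(* The weight alone may be large, but the weighted mass is a product of two conditional
   probabilities, hence at most 1. *)
move=> x; rewrite -cond_prob_cellE// mulr_ge0 ?cond_prob_ge0//=.
apply: mulr_ile1; rewrite ?cond_prob_ge0//; apply: cond_prob_le1 => //.
- exact: measurable_cell.
- exact: measurable_resp_set.
- exact: measurable_treat_set.
Qed.

Lemma tb_lawE (A : set R) : measurable A -> tb_law F k A =
  ((\int[F]_x (weight k true x * fine (k x (C `&` outcome @^-1` A)))) / Q1)%:E.
Proof.
move=> mA; rewrite /tb_law EFinM; congr (_ * _)%E.
have mo : measurable (outcome @^-1` A : set (unit_data R)).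
  exact: measurable_outcome_preimage.
rewrite /Rintegral fineK; last first.
  by apply: integrable_fin_num => //; exact: integrable_weight_cell.
by apply: eq_integral => x _; rewrite cond_prob_cellE.
Qed.

Hypothesis Q1_gt0 : 0 < Q1.

Lemma tb_law_mixture (A : set R) : measurable A -> tb_law F k A =
  (\int[F]_x ((weight k true x / Q1)%:E * k x (C `&` outcome @^-1` A)))%E.
Proof.
move=> mA; rewrite tb_lawE//.
have mo : measurable (outcome @^-1` A : set (unit_data R)).
  exact: measurable_outcome_preimage.
have iw := integrable_weight_cell mo.
rewrite -RintegralZr// /Rintegral fineK; last first.
  apply: integrable_fin_num => //.
  exact: (integrableZr _ Q1^-1 iw).
apply: eq_integral => x _; rewrite mulrAC EFinM fineK// kernel_fin_num//.
by apply: measurableI => //; exact: measurable_cell.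
Qed.

Lemma tb_lawT : tb_law F k setT = 1%E.
Proof.
rewrite tb_lawE// preimage_setT setIT.
under eq_Rintegral do rewrite -resp_rateE.
by rewrite divff// gt_eqF.
Qed.

Hypothesis ae_w : {ae F, forall x, 0 < weight k true x}.
Hypothesis ae_atomless : {ae F, forall x, (0 < k x C)%E ->
  forall y, k x (C `&` outcome @^-1` [set y]) = 0%E}.

Lemma tb_law_atomless y : tb_law F k [set y] = 0%E.
Proof.
have mo : measurable (outcome @^-1` [set y] : set (unit_data R)).
  exact: measurable_outcome_preimage.
rewrite tb_lawE// (ae_eq_Rintegral (g := cst 0)) ?Rintegral_cst// ?mul0r//.
  by have /integrableP[/measurable_EFinP] := integrable_weight_cell mo.
apply: filterS ae_atomless => x atom /=.
have [C0|C0] := ltP 0%E (k x C); first by rewrite atom ?mulr0.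
have mC : measurable C by exact: measurable_cell.
suff -> : k x (C `&` outcome @^-1` [set y]) = 0%E by rewrite mulr0.
apply/eqP; rewrite -measure_le0; apply: le_trans C0.
by rewrite le_measure ?inE//; exact: measurableI.
Qed.

(** An instance of [quantile_level] for the identity variable under dG, which is atomless of total
    mass 1. *)
Lemma tb_law_quantile b (q : R) : 0 < q < 1 ->
  fine (tb_law F k (side b (quantile (tb_cdf F k) (level b q)))) = q.
Proof.
move=> q01.
have tb01 : (0 < tb_law F k setT < +oo)%E by rewrite tb_lawT ltry lte01.
have atom y : tb_law F k (setT `&` idfun @^-1` [set y]) = 0%E.
  by rewrite setTI preimage_id tb_law_atomless.
have cdfE : (fun y : R => cond_prob (tb_law F k) [set v | idfun v <= y] setT) =
    tb_cdf F k.
  apply/funext => y; rewrite /cond_prob /= setIT tb_lawT divr1.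
  have -> : [set v : R | idfun v <= y] = `]-oo, y]%classic.
    by apply/seteqP; split => v /=; rewrite in_itv.
  by rewrite tb_law_cdf.
have h := @quantile_level _ _ _ (tb_law F k) setT idfun measurableT tb01
  (@measurable_id _ _ _) atom b q q01.
by rewrite cdfE setTI preimage_id /= tb_lawT in h; rewrite h /= mulr1.
Qed.

Section mean.
Hypothesis int_outcome : {ae F, forall x, (k x).-integrable C (EFin \o outcome)}.
Hypothesis int_abs : F.-integrable setT
  (EFin \o (fun x => weight k true x * \int[k x]_(v in C) `|outcome v|)).

Let w' x := weight k true x / Q1.

Let w'_ge0 x : 0 <= w' x.
Proof. by rewrite divr_ge0 ?weight_ge0// ltW. Qed.

Let mw' : measurable_fun setT w'.
Proof. by apply: measurable_funM => //; exact: measurable_weight. Qed.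

Let ae_w' : {ae F, forall x, 0 < w' x}.
Proof. by apply: filterS ae_w => x w0; rewrite divr_gt0. Qed.

Let mC : measurable C. Proof. exact: measurable_cell. Qed.

Lemma integrable_tb_law : (tb_law F k).-integrable setT (EFin \o idfun).
Proof.
apply/integrableP; split.
  by apply/measurable_EFinP; exact: measurable_id.
rewrite (@ge0_integral_weighted_mixture _ _ _ _ _ _ _ F k w' C outcome)//=;
  [|exact: measurable_outcome|exact: tb_law_mixture|].
- have := integrable_lty measurableT (integrableZl measurableT Q1^-1 int_abs).
  congr (_ < _)%E; apply: ae_eq_integral => //.
  + exact: measurable_int (integrableZl measurableT Q1^-1 int_abs).
  + apply: emeasurable_funM; first exact/measurable_EFinP.
    apply: (measurable_ge0_integral_section _ mC) => //.
    by do 2 apply: measurableT_comp => //; exact: measurable_outcome.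
  + apply: filterS int_outcome => x ix _ /=.
    have iax := integrable_norm ix.
    rewrite -EFinM mulrA mulrC -/(w' x) [Q1^-1 * _]mulrC -/(w' x) mulrC EFinM.
    by rewrite /Rintegral fineK//; exact: integrable_fin_num.
- exact: measurableT_comp.
Qed.

(** The mixture formula for the identity cut to [A]; clearing the normalization Q1 makes the
    right-hand side comparable with the numerator of the tightened bound. *)
Lemma Rintegral_tb_law (A : set R) : measurable A ->
  F.-integrable setT (EFin \o (fun x =>
    weight k true x * \int[k x]_(v in C `&` outcome @^-1` A) outcome v)) /\
  Q1 * \int[tb_law F k]_(y in A) y = \int[F]_x
    (weight k true x * \int[k x]_(v in C `&` outcome @^-1` A) outcome v).
Proof.
move=> mA; pose g : R -> R := idfun \_ A.
have mg : measurable_fun setT g.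
  apply/(measurable_restrictT _ _).1 => //.
  by apply: measurable_funTS; exact: measurable_id.
have ig : (tb_law F k).-integrable setT (EFin \o g).
  rewrite /g -restrict_EFin; apply/(integrable_mkcond _ mA).
  exact: integrableS integrable_tb_law.
have wE x : weighted_section k w' C outcome g x = Q1^-1 *
    (weight k true x * \int[k x]_(v in C `&` outcome @^-1` A) outcome v).
  rewrite /weighted_section mulrA [Q1^-1 * _]mulrC; congr (_ * _).
  rewrite [RHS]Rintegral_mkcondr; apply: eq_Rintegral => v _; rewrite /g !patchE.
  by have -> : (v \in outcome @^-1` A) = (outcome v \in A)
    by apply/idP/idP; rewrite !inE.
have iw : F.-integrable setT (EFin \o weighted_section k w' C outcome g).
  apply: (@integrable_weighted_section _ _ _ _ _ _ _ F k w' C outcome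
    (tb_law F k)) => //; [exact: measurable_outcome|exact: tb_law_mixture].
have iw1 : F.-integrable setT (EFin \o (fun x =>
    weight k true x * \int[k x]_(v in C `&` outcome @^-1` A) outcome v)).
  apply: eq_integrable (integrableZl measurableT Q1 iw) => // x _ /=.
  by rewrite wE -EFinM mulrA divff ?mul1r// gt_eqF.
split=> //.
have -> : \int[tb_law F k]_(y in A) y = \int[F]_x weighted_section k w' C outcome g x.
  rewrite Rintegral_mkcond; apply: (@Rintegral_weighted_mixture _ _ _ _ _ _ _
    F k w' C outcome (tb_law F k)) => //;
    [exact: measurable_outcome|exact: tb_law_mixture].
have -> : \int[F]_x weighted_section k w' C outcome g x = Q1^-1 * \int[F]_x
    (weight k true x * \int[k x]_(v in C `&` outcome @^-1` A) outcome v).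
  by rewrite -RintegralZl//; apply: eq_Rintegral => x _; exact: wE.
by rewrite mulrA divff ?mul1r// gt_eqF.
Qed.

End mean.
End basic_law.

(** * The chain of inequalities *)

Section trimming_bounds.
Context {R : realType} {p : nat} d {Omega : measurableType d}.
Variables (P : probability Omega R) (X : {RV P >-> p.-tuple R}).
Variables (D S0 S1 : {RV P >-> bool}) (Y0 Y1 : {RV P >-> R}).
Variable k : R.-pker (p.-tuple R) ~> (unit_data R).
Local Notation F := (distribution P X).
Local Notation pot := (potentials S0 S1 Y0 Y1).
Local Notation C := (cell true : set (unit_data R)).
Hypothesis iY0 : P.-integrable setT (EFin \o Y0).
Hypothesis iY1 : P.-integrable setT (EFin \o Y1).
Hypothesis pos : (0 < P (pot @^-1` always_responds))%E.
Hypothesis rcd : is_rcd X (joint D S0 S1 Y0 Y1) k.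
Hypothesis cont : continuous_outcome F k.
Hypothesis ign : strong_ignorability F k.
Hypothesis mono : {ae P, forall w, (S0 w <= S1 w)%N}.

(** The units that monotonic selection excludes up to a null set. *)
Let defiers : set (potential R) := ever_responds false `\` ever_responds true.

Let m_defiers : measurable defiers.
Proof. by apply: measurableD; exact: measurable_ever_responds. Qed.

Let msnd (A : set (potential R)) : measurable A ->
  measurable (snd @^-1` A : set (unit_data R)).
Proof.
by move=> mA; rewrite -[X in measurable X]setTI; exact: measurable_snd.
Qed.

Let mpot (A : set (potential R)) : measurable A -> measurable (pot @^-1` A).
Proof. by move=> mA; exact: measurable_funPTI. Qed.

Let P_defiers : P (pot @^-1` defiers) = 0%E.
Proof.
apply/negligibleP; first exact: mpot.
apply: negligibleS mono => o /= [/= s0 s1]; rewrite /ever_responds/= in s0 s1 *.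
by rewrite s0; case: (S1 o) s1.
Qed.

Let ever_respondsE :
  ever_responds false = always_responds `|` defiers :> set (potential R).
Proof.
apply/seteqP; split => q; rewrite /ever_responds /always_responds /defiers/=.
  by move=> q0; have [q1|q1] := pselect (q.1.2 = true); [left|right].
by case=> -[].
Qed.

Let ae_defiers : {ae F, forall x, k x (snd @^-1` defiers) = 0%E}.
Proof.
have mk : measurable_fun setT (fun x => k x (snd @^-1` defiers)).
  by apply: measurable_kernel; exact: msnd.
have /(ae_eq_integral_abs F measurableT mk) :
    (\int[F]_x `|k x (snd @^-1` defiers)| = 0)%E.
  under eq_integral do rewrite gee0_abs//.
  by rewrite -(marginal_law rcd)// P_defiers.
by apply: filterS => x; exact.
Qed.

Let ae_weight_gt0 : {ae F, forall x, 0 < weight k true x}.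
Proof. by apply: filterS (ae_weight_gt0 ign) => x; exact. Qed.

Let fine_weight a x (A : set (unit_data R)) : measurable A ->
  weight k a x * fine (k x A) = fine ((weight k a x)%:E * k x A)%E.
Proof. by move=> mA; rewrite fineM// kernel_fin_num. Qed.

(** Weighting takes each arm to the conditional law given X. There the units with S(0) = 1 are the
    always-responders up to null defiers, so a rate read off the untreated arm becomes a mass in the
    treated one. *)
Let ae_resp_rate0E : {ae F, forall x,
  resp_rate k false x = weight k true x * fine (k x (C `&` responds0))}.
Proof.
have ma := @measurable_always_responds R.
have mf := @measurable_ever_responds R false.
have h0 := ae_weight_arm ign false mf.
have h1 := ae_weight_arm ign true ma.
apply: filterS3 h0 h1 ae_defiers => x e0 e1 x0.
rewrite resp_rateE cellE cell_responds0E !fine_weight; last 2 first.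
- exact: measurable_arm_preimage.
- exact: measurable_arm_preimage.
rewrite e0 e1 ever_respondsE preimage_setU measureU0//.
- exact: msnd.
- exact: msnd.
Qed.

Let Q0 := \int[F]_x resp_rate k false x.
Let Q1 := \int[F]_x resp_rate k true x.

Let Q0E : Q0 = fine (P (pot @^-1` always_responds)).
Proof.
have ma := @measurable_always_responds R.
rewrite (inverse_probability_law rcd ign true)//; congr fine.
have mw : measurable_fun setT (fun x =>
    (weight k true x)%:E * k x (arm true `&` snd @^-1` always_responds))%E.
  apply: emeasurable_funM.
    by apply/measurable_EFinP; exact: measurable_weight.
  by apply: measurable_kernel; exact: measurable_arm_preimage.
apply: ae_eq_integral => //.
  by apply/measurable_EFinP; exact: measurable_resp_rate.
apply: filterS ae_resp_rate0E => x -> _.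
rewrite cell_responds0E EFinM fineK// kernel_fin_num//.
exact: measurable_arm_preimage.
Qed.

Let Q0_gt0 : 0 < Q0.
Proof.
have ma := mpot (@measurable_always_responds R).
by rewrite Q0E fine_gt0// pos (le_lt_trans (probability_le1 P ma)) ?ltry.
Qed.

Let mC : measurable C. Proof. exact: measurable_cell. Qed.

Let ae_resp_rate_le : {ae F, forall x, resp_rate k false x <= resp_rate k true x}.
Proof.
apply: filterS ae_resp_rate0E => x ->.
rewrite resp_rateE ler_wpM2l ?weight_ge0// fine_le ?kernel_fin_num//.
- by apply: measurableI => //; exact: measurable_responds0.
- rewrite le_measure ?inE//.
  by apply: measurableI => //; exact: measurable_responds0.
Qed.

Let Q0_le_Q1 : Q0 <= Q1.
Proof. by apply: ae_le_Rintegral => //; exact: integrable_resp_rate. Qed.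

Let Q1_gt0 : 0 < Q1. Proof. exact: lt_le_trans Q0_le_Q1. Qed.

(** The mass of the untreated cell cancels; where it is zero both sides are zero, in accordance with
    the convention for the integrand. *)
Let theta0E x : theta0 k x * resp_rate k false x =
  weight k false x *
    \int[k x]_(v in arm false `&` snd @^-1` ever_responds false) outcome v.
Proof.
rewrite /theta0 /cond_mean resp_rateE -cellE.
have [c0|c0] := eqVneq (fine (k x (cell false))) 0; last by rewrite mulrCA divfK.
have mc : measurable (cell false : set (unit_data R)) by exact: measurable_cell.
rewrite c0 invr0 !mulr0 /Rintegral null_set_integral ?mulr0//.
  apply/measurable_EFinP; apply: measurable_funTS; exact: measurable_outcome.
by rewrite -[LHS]fineK ?c0// kernel_fin_num.
Qed.

Let N0 := \int[F]_x (theta0 k x * resp_rate k false x).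
Let Eresp a := \int[P]_(o in pot @^-1` always_responds) response a (pot o).

Let integrable_theta0 :
  F.-integrable setT (EFin \o (fun x => theta0 k x * resp_rate k false x)).
Proof.
have me := @measurable_ever_responds R false.
have := integrable_weighted_response rcd ign (a := false)
  (@measurable_id _ R setT) iY0 me.
by apply: eq_integrable => // x _ /=; rewrite theta0E.
Qed.

(** The untreated cell yields the integral of Y(0) over S(0) = 1; removing the null defiers leaves
    the always-responders. *)
Let N0E : N0 = Eresp false.
Proof.
have me := @measurable_ever_responds R false.
have ma := @measurable_always_responds R.
transitivity (\int[P]_(o in pot @^-1` ever_responds false) response false (pot o)).
  rewrite (Rintegral_weighted_response rcd ign (a := false) (h := idfun)
    (@measurable_id _ R setT) iY0 me).
  by apply: eq_Rintegral => x _; rewrite theta0E.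
rewrite /Eresp /Rintegral (@negligible_integral _ _ _ _ _ (pot @^-1` defiers))//.
- congr (fine (integral _ _ _)); rewrite ever_respondsE.
  apply/seteqP; split => o /=; rewrite /defiers/=; first by case=> -[].
  by move=> qa; split; [left|case=> _ ; apply; case: qa].
- exact: mpot.
- exact: mpot.
- by apply: integrableS iY0 => //; exact: mpot.
Qed.

Let tau_11E : tau_11 P S0 S1 Y0 Y1 = (Eresp true - Eresp false) / Q0.
Proof.
have ma := mpot (@measurable_always_responds R).
rewrite /tau_11 /cond_mean Q0E; congr (_ / _).
by rewrite (RintegralB ma)//; [exact: integrableS iY1|exact: integrableS iY0].
Qed.

Let ae_int_outcome : {ae F, forall x, (k x).-integrable C (EFin \o outcome)}.
Proof. exact: (ae_integrable_arm rcd ign (a := true) iY1). Qed.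

Let ae_atomless := ae_cell_atomless cont.

Let integrable_abs_outcome : F.-integrable setT
  (EFin \o (fun x => weight k true x * \int[k x]_(v in C) `|outcome v|)).
Proof.
have me := @measurable_ever_responds R true.
rewrite cellE; apply: (integrable_weighted_response rcd ign (a := true)
  (h := Num.norm) _ _ me) => //.
exact: integrable_norm iY1.
Qed.

(** All conditions of the pointwise comparison, holding together off one null set. *)
Let ae_regular : {ae F, forall x, [/\ 0 < weight k true x,
  resp_rate k false x = weight k true x * fine (k x (C `&` responds0)),
  (k x).-integrable C (EFin \o outcome) &
  (0 < k x C)%E -> forall y, k x (C `&` outcome @^-1` [set y]) = 0%E]}.
Proof.
apply: filterS2 (filterI ae_weight_gt0 ae_resp_rate0E)
  (filterI ae_int_outcome ae_atomless) => x [w0 r0] [io at0].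
by split.
Qed.

Let integrable_ctb b : F.-integrable setT (EFin \o ctb_integrand k b).
Proof.
apply: ae_le_integrable integrable_abs_outcome _.
  exact: measurable_ctb_integrand.
by apply: filterS ae_regular => x [w0 r0 io at0]; exact: normr_ctb_integrand.
Qed.

Let tau_CTB b := ctb_bound F k (theta1 k b).

Let tau_CTBE b : tau_CTB b = (\int[F]_x ctb_integrand k b x - Eresp false) / Q0.
Proof.
rewrite -N0E /tau_CTB /ctb_bound -/Q0; congr (_ / _).
rewrite -RintegralB//; apply: eq_Rintegral => x _.
by rewrite mulrBl.
Qed.

Let Eresp1E : Eresp true = \int[F]_x
  (weight k true x * \int[k x]_(v in C `&` responds0) outcome v).
Proof.
have ma := @measurable_always_responds R.
rewrite /Eresp (Rintegral_weighted_response rcd ign (a := true) (h := idfun)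
  (@measurable_id _ R setT) iY1 ma).
by apply: eq_Rintegral => x _; rewrite cell_responds0E.
Qed.

Let integrable_always : F.-integrable setT (EFin \o (fun x =>
  weight k true x * \int[k x]_(v in C `&` responds0) outcome v)).
Proof.
have ma := @measurable_always_responds R.
rewrite cell_responds0E.
exact: (integrable_weighted_response rcd ign (a := true) (h := idfun)
  (@measurable_id _ R setT) iY1 ma).
Qed.

(** Both sides share the denominator Q0 and the untreated term, which leaves two integrals over x to
    be compared pointwise. *)
Lemma ctb_bound_tau_11 b :
  sgb b * tau_CTB b <= sgb b * tau_11 P S0 S1 Y0 Y1.
Proof.
rewrite tau_CTBE tau_11E !mulrA ler_pM2r ?invr_gt0// !mulrBr lerD2r Eresp1E.
rewrite -!RintegralZl//; apply: ae_le_Rintegral.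
- exact: (integrableZl measurableT (sgb b) (integrable_ctb b)).
- exact: (integrableZl measurableT (sgb b) integrable_always).
apply: filterS ae_regular => x [w0 r0 io at0].
by have [A [_ _ _ _ []]] := ctb_integrand_trimmed b w0 r0 io at0.
Qed.

Let tau_TB b : R := (tb_ratio F k)^-1 *
    (\int[tb_law F k]_(y in (if tb_ratio F k == 1 then setT
       else side b (quantile (tb_cdf F k) (level b (tb_ratio F k))))) y)
  - mu0 F k.

Let int_weight_mean (A : set R) : measurable A ->
  F.-integrable setT (EFin \o (fun x =>
    weight k true x * \int[k x]_(v in C `&` outcome @^-1` A) outcome v)) /\
  Q1 * \int[tb_law F k]_(y in A) y = \int[F]_x
    (weight k true x * \int[k x]_(v in C `&` outcome @^-1` A) outcome v).
Proof.
exact: (Rintegral_tb_law Q1_gt0 ae_weight_gt0 ae_int_outcome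
  integrable_abs_outcome).
Qed.

(** Almost everywhere q_0 <= q_1, so the difference is nonnegative with zero integral. *)
Let ae_rate_eq : Q0 = Q1 ->
  {ae F, forall x, resp_rate k false x = resp_rate k true x}.
Proof.
move=> Q01; pose f x := resp_rate k true x - resp_rate k false x.
have i0 := integrable_resp_rate F k false.
have i1 := integrable_resp_rate F k true.
have mf : measurable_fun setT (EFin \o f).
  by apply/measurable_EFinP/measurable_funB; exact: measurable_resp_rate.
have : (\int[F]_x `|(EFin \o f) x| = 0)%E.
  transitivity (\int[F]_x (EFin \o f) x)%E.
    apply: ae_eq_integral => //; first exact: measurableT_comp.
    by apply: filterS ae_resp_rate_le => x r01 _ /=; rewrite ger0_norm// subr_ge0.
  transitivity (\int[F]_x f x)%:E.
    rewrite /Rintegral fineK//; apply: integrable_fin_num => //.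
    by have i10 := integrableB measurableT i1 i0; exact i10.
  by rewrite RintegralB// -/Q0 -/Q1 Q01 subrr.
move/(ae_eq_integral_abs F measurableT mf).
apply: filterS => x /(_ I) [] /eqP.
by rewrite subr_eq0 => /eqP ->.
Qed.

Let tb_le_ctb b (E := if tb_ratio F k == 1 then setT
    else side b (quantile (tb_cdf F k) (level b (tb_ratio F k)))) :
  sgb b * (Q1 * \int[tb_law F k]_(y in E) y) <=
  sgb b * \int[F]_x ctb_integrand k b x.
Proof.
have qE : tb_ratio F k = Q0 / Q1 by [].
(* Without trimming in the aggregate, the rates agree at almost every x; neither bound trims and
   equality holds. *)
rewrite /E; have [q1|qn1] := eqVneq (tb_ratio F k) 1.
  have Q01 : Q0 = Q1.
    by apply: (divIf (lt0r_neq0 Q1_gt0)); rewrite -qE q1 divff// gt_eqF.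
  have ae_eq_rate := ae_rate_eq Q01.
  have [iT ->] := int_weight_mean measurableT.
  rewrite le_eqVlt; apply/orP; left; apply/eqP; congr (_ * _).
  apply: ae_eq_Rintegral.
  - by have /integrableP[/measurable_EFinP] := iT.
  - exact: measurable_ctb_integrand.
  apply: filterS2 ae_regular ae_eq_rate => x [w0 r0 io at0] e.
  have [A [_ _ _ _ [_ ->//]]] := ctb_integrand_trimmed b w0 r0 io at0.
  by rewrite preimage_setT setIT.
have q01 : 0 < tb_ratio F k < 1.
  apply/andP; split; first by rewrite qE divr_gt0.
  by rewrite lt_neqAle qn1 qE ler_pdivrMr// mul1r.
set c := quantile _ _.
have ms := measurable_side b c.
have mos := measurable_outcome_preimage ms.
have [iS ->] := int_weight_mean ms.
have iw := integrable_weight_cell F k mos.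
(* The tail has dG-mass Q0 / Q1; undoing the normalization gives Q0. *)
have wQ0 : \int[F]_x (weight k true x *
    fine (k x (C `&` outcome @^-1` side b c))) = Q0.
  have := tb_law_quantile Q1_gt0 ae_atomless b q01.
  rewrite -/c tb_lawE//= qE -/Q1 => /(divIf (lt0r_neq0 Q1_gt0)).
  exact.
(* Subtract c Q0 from both sides, reading Q0 as the total mass of the common tails on the left and
   as the integral of q_0 on the right; the bathtub inequality then holds x by x. *)
rewrite -(lerD2r (- (sgb b * (c * Q0)))) -!mulrBr -{1}wQ0 /Q0.
rewrite -!RintegralZl//; last exact: integrable_resp_rate.
have icw := integrableZl measurableT c iw.
have icr := integrableZl measurableT c (integrable_resp_rate F k false).
have iL := integrableB measurableT iS icw.
have iR := integrableB measurableT (integrable_ctb b) icr.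
rewrite -RintegralB// -[X in _ <= _ * X]RintegralB//.
rewrite -(RintegralZl _ measurableT iL) -(RintegralZl _ measurableT iR).
apply: ae_le_Rintegral.
- by have h := integrableZl measurableT (sgb b) iL; exact h.
- by have h := integrableZl measurableT (sgb b) iR; exact h.
apply: filterS ae_regular => x [w0 r0 io at0].
exact: ctb_integrand_bathtub.
Qed.

Lemma tb_bound_ctb_bound b : sgb b * tau_TB b <= sgb b * tau_CTB b.
Proof.
have mu0E : mu0 F k = Eresp false / Q0 by rewrite -N0E.
rewrite tau_CTBE /tau_TB mu0E mulrBl !mulrBr lerD2r.
have -> : (tb_ratio F k)^-1 = Q1 / Q0 by rewrite /tb_ratio invf_div.
by rewrite mulrAC mulrA [leRHS]mulrA ler_pM2r ?invr_gt0.
Qed.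

End trimming_bounds.

Theorem mainTheorem2 (R : realType) (p : nat)
  (d : measure_display) (Omega : measurableType d) (P : probability Omega R)
  (X : {RV P >-> p.-tuple R}) (D S0 S1 : {RV P >-> bool})
  (Y0 Y1 : {RV P >-> R})
  (k : R.-pker (p.-tuple R) ~> (unit_data R)) :
  P.-integrable setT (EFin \o Y0) ->
  P.-integrable setT (EFin \o Y1) ->
  (0 < P [set w | S0 w = true /\ S1 w = true])%E ->
  is_rcd X (joint D S0 S1 Y0 Y1) k ->
  continuous_outcome (distribution P X) k ->
  strong_ignorability (distribution P X) k ->
  {ae P, forall w, (S0 w <= S1 w)%N} ->
  [/\ tau_TB_L (distribution P X) k <= tau_CTB_L (distribution P X) k,
      tau_CTB_L (distribution P X) k <= tau_11 P S0 S1 Y0 Y1,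
      tau_11 P S0 S1 Y0 Y1 <= tau_CTB_U (distribution P X) k &
      tau_CTB_U (distribution P X) k <= tau_TB_U (distribution P X) k].
Proof.
move=> iY0 iY1 pos rcd cont ign mono.
have tb b := tb_bound_ctb_bound iY0 iY1 pos rcd cont ign mono b.
have ctb b := ctb_bound_tau_11 iY0 iY1 pos rcd cont ign mono b.
split.
- by have := tb true; rewrite /sgb !mul1r.
- by have := ctb true; rewrite /sgb !mul1r.
(* The sign -1 reverses the comparison. *)
- by have := ctb false; rewrite /sgb !mulN1r lerN2.
- by have := tb false; rewrite /sgb !mulN1r lerN2.
Qed.
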